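(* Let $k\ge2$. On a cuboid cell $T$ let $\boldsymbol X_T$ be the space of vector fields $\boldsymbol u=(u_1,u_2,u_3)$ with $u_i\in\mathcal Q(i{:}k,j{:}k+1,l{:}k+1)$ for each $i$. The following degrees of freedom, taken for $i=1,2,3$, are unisolvent for $\boldsymbol X_T$: (a) $u_i,\partial_ju_i,\partial_lu_i,\partial_j\partial_lu_i$ at each vertex; (b) moments of $u_i,\partial_ju_i,\partial_lu_i,\partial_j\partial_lu_i$ on each edge $e_i$ against $\mathcal Q(i{:}k-2)$; (c) for each $j\ne i$, moments of $u_i,\partial_lu_i$ on each edge $e_j$ against $\mathcal Q(j{:}k-3)$; (d) moments of $u_i$ on each face $F_{jl}$ (normal to the $x_i$-direction) against $\mathcal Q(j{:}k-3,l{:}k-3)$; (e) for each $j\neq i$, moments of $u_i,\partial_lu_i$ on each face $F_{ij}$ against $\mathcal Q(i{:}k-2,j{:}k-3)$; (f) moments of $u_i$ on $T$ against $\mathcal Q(i{:}k-2,j{:}k-3,l{:}k-3)$. Moreover, the resulting finite element space $\boldsymbol X_h$ on $\mathcal T_h$ is $\boldsymbol H^1$ conforming, i.e. $\boldsymbol X_h\subset H^1(\Omega;\mathbb R^3)$.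
   Context: Coordinates are $(x_1,x_2,x_3)=(x,y,z)$, $\partial_i=\partial/\partial x_i$. Whenever indices $i,j,l$ occur together they are pairwise distinct, i.e. $\{i,j,l\}=\{1,2,3\}$. $\mathcal Q(i{:}a,j{:}b,l{:}c)$ is the space of polynomials of degree at most $a$ in $x_i$, at most $b$ in $x_j$ and at most $c$ in $x_l$ (separately); similarly with fewer variables on faces and edges; it is the zero space if some bound is negative (the corresponding degrees of freedom are then absent). $\Omega\subset\mathbb R^3$ is a contractible domain with Lipschitz boundary, partitioned by a (face-to-face) mesh $\mathcal T_h$ of axis-parallel cuboids. $e_i$ denotes an edge parallel to the $x_i$-axis; $F_{ij}=F_{ji}$ denotes a face parallel to the $x_i$- and $x_j$-axes. ''Moments of $f$ on $G$ against $P$'' means the functionals $\int_G f\,p$, $p\in P$ (with $p$ running over a basis of $P$ when counting). Degrees of freedom are unisolvent for a shape function space if they form a basis of its dual space. The resulting finite element space consists of all fields on $\Omega$ whose restriction to each cell is in the shape function space and such that each degree of freedom attached to a vertex, edge or face has the same value from all cells containing that vertex, edge or face. *)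

(* Defs.v *)
From HB Require Import structures.
From mathcomp Require Import all_boot all_order all_algebra.
From mathcomp Require Import all_classical all_reals all_analysis.

Set Implicit Arguments.
Unset Strict Implicit.
Unset Printing Implicit Defensive.

Import Order.TTheory GRing.Theory Num.Theory.
Import numFieldNormedType.Exports.

Local Open Scope classical_set_scope.
Local Open Scope ring_scope.

Section Defs.
Variable R : realType.

(* Points of, and vectors in, R^3; the coordinates (x_1, x_2, x_3) are
   x 0 0, x 0 1, x 0 2. *)
Local Notation pt := 'rV[R]_3.

Implicit Types (f g p : pt -> R) (u w : pt -> pt) (i m : 'I_3).

Definition pderiv m f : pt -> R := fun x => 'D_(delta_mx 0 m) f x.

(* pderivs [:: j; l] f is d_j (d_l f) *)
Definition pderivs (D : seq 'I_3) f : pt -> R := foldr pderiv f D.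

Definition comp u i : pt -> R := fun x => u x 0 i.

(* [:: (i, a); (j, b); (l, c)] stands for the bounds (i:a, j:b, l:c); the
   polynomials do not depend on the variables which are not listed. *)
Definition bounds := seq ('I_3 * int).

Definition bound (d : bounds) m : int :=
  foldr (fun mb b => if mb.1 == m then mb.2 else b) 0 d.

(* the number of exponents e >= 0 with e <= b, which is 0 when b < 0 *)
Definition nexp (b : int) : nat := if b is Posz n then n.+1 else 0%N.

Definition Q (d : bounds) : set (pt -> R) :=
  [set p : pt -> R | exists c : nat -> nat -> nat -> R, forall x : pt,
     p x = \sum_(a0 < nexp (bound d 0)) \sum_(a1 < nexp (bound d 1))
           \sum_(a2 < nexp (bound d 2))
             c a0 a1 a2 * (x 0 0 ^+ a0 * x 0 1 ^+ a1 * x 0 2 ^+ a2)].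

(* (a, b) represents the axis-parallel box of the x with a_m <= x_m <= b_m. *)
Definition box := (pt * pt)%type.

Definition cell (T : box) : set pt :=
  [set x | forall m, T.1 0 m <= x 0 m <= T.2 0 m].

Definition open_cell (T : box) : set pt :=
  [set x | forall m, T.1 0 m < x 0 m < T.2 0 m].

Definition cuboid (T : box) : Prop := forall m, T.1 0 m < T.2 0 m.

(* A position e selects a vertex, edge, face of a cuboid or the cuboid itself:
   along x_m it is the full interval if e m = None, and the lower or upper end
   point if e m is Some false or Some true. *)
Definition position := {ffun 'I_3 -> option bool}.

Definition dirs (e : position) : {set 'I_3} := [set m | e m == None].

Definition subbox (T : box) (e : position) : box :=
  (\row_m (if e m == Some true then T.2 0 m else T.1 0 m),
   \row_m (if e m == Some false then T.1 0 m else T.2 0 m)).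

Definition positions (S : {set 'I_3}) : seq position :=
  [seq e <- enum {: position} | dirs e == S].

Definition set_coord (x : pt) m (t : R) : pt :=
  \row_n (if n == m then t else x 0 n).

Definition int_dir (G : box) m f : pt -> R := fun x =>
  \int[@lebesgue_measure R]_(t in `[G.1 0 m, G.2 0 m]) f (set_coord x m t).

(* For a box G which is degenerate exactly in the directions outside S, the
   integral over G with respect to the #|S|-dimensional measure, written as an
   iterated integral; all integrands below are polynomial. *)
Definition int_box (G : box) (S : seq 'I_3) f : R :=
  foldr (int_dir G) f S G.1.

Definition shape_space (k : nat) : set (pt -> pt) :=
  [set u | forall i,
     Q [:: (i, k%:Z); (i + 1, k%:Z + 1); (i + 2, k%:Z + 1)] (comp u i)].

(* (D, d) stands for the moments of pderivs D u_i against Q d, on the edges,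
   faces or cell extending exactly in the directions listed in d. *)
Definition moment_type := (seq 'I_3 * bounds)%type.

Definition moment_dirs (r : moment_type) : {set 'I_3} :=
  [set m in unzip1 r.2].

Definition moment (G : box) (r : moment_type) f p : R :=
  int_box G (unzip1 r.2) (fun x => pderivs r.1 f x * p x).

(* For a component i, the two other directions are i + 1 and i + 2 mod 3. *)
Definition others i : seq ('I_3 * 'I_3) :=
  [:: (i + 1, i + 2); (i + 2, i + 1)].

Definition transverse_derivs i : seq (seq 'I_3) :=
  [:: [::]; [:: i + 1]; [:: i + 2]; [:: i + 1; i + 2]].

Definition vertex_derivs := transverse_derivs.

Definition edge_moments (k : nat) i : seq moment_type :=
  [seq (D, [:: (i, k%:Z - 2)]) | D <- transverse_derivs i] ++
  [seq (D, [:: (jl.1, k%:Z - 3)]) | jl <- others i, D <- [:: [::]; [:: jl.2]]].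

Definition face_moments (k : nat) i : seq moment_type :=
  ([::], [:: (i + 1, k%:Z - 3); (i + 2, k%:Z - 3)]) ::
  [seq (D, [:: (i, k%:Z - 2); (jl.1, k%:Z - 3)])
     | jl <- others i, D <- [:: [::]; [:: jl.2]]].

Definition cell_moments (k : nat) i : seq moment_type :=
  [:: ([::], [:: (i, k%:Z - 2); (i + 1, k%:Z - 3); (i + 2, k%:Z - 3)])].

Definition moments (k : nat) i : seq moment_type :=
  edge_moments k i ++ face_moments k i ++ cell_moments k i.

(* B i r e lists the test functions used for the moments of type r of the i-th
   component on the edge, face or cell at position e. *)
Definition dofs (k : nat) (T : box)
    (B : 'I_3 -> moment_type -> position -> seq (pt -> R)) :
    seq ((pt -> pt) -> R) :=
  flatten [seq
    [seq (fun u => pderivs D (comp u i) (subbox T v).1)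
       | D <- vertex_derivs i, v <- positions finset.set0] ++
    flatten [seq
      [seq (fun u => moment (subbox T e) r (comp u i) p)
         | e <- positions (moment_dirs r), p <- B i r e]
      | r <- moments k i]
    | i <- enum 'I_3].

(* b is a basis of the space P of functions on X; functions on X are given by
   functions on U, up to equality on X. *)
Definition is_basis (U : Type) (X : set U) (P : set (U -> R))
    (b : seq (U -> R)) : Prop :=
  (forall n, (n < size b)%N -> P (nth (fun=> 0) b n)) /\
  forall f : U -> R, P f -> exists! c : 'rV[R]_(size b),
    forall x, X x -> f x = \sum_(n < size b) c 0 n * nth (fun=> 0) b n x.

Definition dual_space (X : set (pt -> pt)) : set ((pt -> pt) -> R) :=
  [set phi | forall (a : R) u w, X u -> X w ->
     phi (fun x => a *: u x + w x) = a * phi u + phi w].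

Definition unisolvent (X : set (pt -> pt)) (L : seq ((pt -> pt) -> R)) : Prop :=
  is_basis X (dual_space X) L.

Definition contractible (Omega : set pt) : Prop :=
  exists (x0 : pt) (H : R * pt -> pt),
  [/\ Omega x0,
      {within `[0, 1] `*` Omega, continuous H},
      (forall t x, 0 <= t <= 1 -> Omega x -> Omega (H (t, x))),
      (forall x, Omega x -> H (0, x) = x) &
      (forall x, Omega x -> H (1, x) = x0)].

(* Near each boundary point, in suitable orthonormal coordinates, the domain is
   the set of points above the graph of a Lipschitz function. *)
Definition lipschitz_boundary (Omega : set pt) : Prop :=
  forall x0, (closure Omega `\` interior Omega) x0 ->
  exists (A : 'M[R]_3) (gamma : R * R -> R) (r : R),
  [/\ A *m A^T = 1%:M, lipschitz gamma, 0 < r &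
      forall x, ball x0 r x ->
        let y := x *m A in
        Omega x <-> gamma (y 0 0, y 0 1) < y 0 2].

Definition is_mesh (Omega : set pt) (Th : seq box) : Prop :=
  [/\ (forall T, T \in Th -> cuboid T),
      closure Omega = \bigcup_(T in [set T | T \in Th]) cell T,
      (forall T T', T \in Th -> T' \in Th -> T != T' ->
         open_cell T `&` open_cell T' = set0) &
      (forall T T', T \in Th -> T' \in Th ->
         cell T `&` cell T' = set0 \/
         exists e e', subbox T e = subbox T' e' /\
           cell T `&` cell T' = cell (subbox T e))].

(* w T is the restriction of u to the cell T.  A field in the space is only
   determined inside the cells: its values on their boundaries, a null set, are
   left arbitrary, while the degrees of freedom refer to the restrictions.  In a
   face-to-face mesh every cell containing a vertex, edge or face G of another cell has G as
   a vertex, edge or face of its own. *)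
Definition fe_space (k : nat) (Th : seq box) : set (pt -> pt) :=
  [set u | exists w : box -> pt -> pt,
   [/\ (forall T, T \in Th -> shape_space k (w T)),
       (forall T x, T \in Th -> open_cell T x -> u x = w T x),
       (forall T T' v v' i D, T \in Th -> T' \in Th ->
          dirs v = finset.set0 -> subbox T v = subbox T' v' ->
          D \in vertex_derivs i ->
          pderivs D (comp (w T) i) (subbox T v).1 =
          pderivs D (comp (w T') i) (subbox T' v').1) &
       (forall T T' e e' i r p, T \in Th -> T' \in Th ->
          subbox T e = subbox T' e' ->
          r \in edge_moments k i ++ face_moments k i ->
          moment_dirs r = dirs e -> Q r.2 p ->
          moment (subbox T e) r (comp (w T) i) p =
          moment (subbox T' e') r (comp (w T') i) p)]].

Definition point3 (z : R * R * R) : pt :=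
  \row_m tnth [tuple z.1.1; z.1.2; z.2] m.

(* the Lebesgue measure on R^3 *)
Definition mu3 := ((@lebesgue_measure R \x @lebesgue_measure R)
                    \x @lebesgue_measure R)%E.

Definition int3 (Omega : set pt) f : R :=
  \int[mu3]_(z in point3 @^-1` Omega) f (point3 z).

Definition L2 (Omega : set pt) f : Prop :=
  measurable_fun (point3 @^-1` Omega) (f \o point3) /\
  mu3.-integrable (point3 @^-1` Omega) (fun z => ((f (point3 z)) ^+ 2)%:E).

Definition ae_eq3 (Omega : set pt) f g : Prop :=
  {ae mu3, forall z, Omega (point3 z) -> f (point3 z) = g (point3 z)}.

Definition smooth f : Prop := forall D : seq 'I_3,
  continuous (pderivs D f) /\
  forall m x, derivable (pderivs D f) x (delta_mx 0 m).

Definition test_function (Omega : set pt) f : Prop :=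
  smooth f /\
  exists K : set pt,
    [/\ compact K, K `<=` Omega & forall x, ~ K x -> f x = 0].

Definition weak_pderiv (Omega : set pt) m f g : Prop :=
  forall phi, test_function Omega phi ->
    int3 Omega (fun x => f x * pderiv m phi x) =
    - int3 Omega (fun x => g x * phi x).

(* Elements of H^1 are classes of almost everywhere equal functions: f belongs
   to H^1 if it has a Borel representative g in L^2 whose weak partial
   derivatives are in L^2. *)
Definition H1 (Omega : set pt) f : Prop :=
  exists g, [/\ ae_eq3 Omega f g, L2 Omega g &
    forall m, exists h, L2 Omega h /\ weak_pderiv Omega m g h].

Definition H1_field (Omega : set pt) : set (pt -> pt) :=
  [set u | forall i, H1 Omega (comp u i)].

End Defs.

(* Main.v *)
(** Each component's degrees of freedom are a tensor product of one-dimensional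
    ones: values at the end points and moments against degree at most k - 2 for
    degree k along x_i, and Hermite data with moments against degree at most
    k - 3 for degree k + 1 along the other two directions.  A polynomial killed
    by the one-dimensional functionals is w g with w >= 0 (up to sign) vanishing
    at the end points, and testing against g gives [int w g^2 = 0].  Eliminating
    one direction at a time, and using only the end point values in the
    directions where a subbox is degenerate, the degrees of freedom on a vertex,
    edge, face or cell determine the restriction of u_i to it.  On the cell this
    is injectivity, which with the dimension count is unisolvence; on common
    subboxes of two cells it says that the pieces agree.

    The weak derivatives are the cellwise ones.  By Fubini and the fundamental
    theorem of calculus along lines parallel to x_m, the integral of the
    cellwise derivatives of u_i phi is an integral of sums of end point
    contributions, and in each of these sums the contribution of the upper end
    point of a cell cancels with that of the lower end point of the next one, or
    vanishes because it lies outside the support of phi. *)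

Require Import Defs.
From HB Require Import structures.
From mathcomp Require Import all_boot all_order all_algebra.
From mathcomp Require Import all_classical all_reals all_analysis.
From mathcomp Require Import measurable_realfun ring lra zify.

Set Implicit Arguments.
Unset Strict Implicit.
Unset Printing Implicit Defensive.

Import Order.TTheory GRing.Theory Num.Theory.
Import numFieldNormedType.Exports.

Local Open Scope classical_set_scope.
Local Open Scope ring_scope.

(** * One-dimensional unisolvence *)

Section PolynomialIntegral.
Variable R : realType.
Implicit Types (a b : R) (q w g : {poly R}).

Definition pint a b q : R := \int[@lebesgue_measure R]_(t in `[a, b]) q.[t].

Lemma integrable_horner a b q :
  (@lebesgue_measure R).-integrable `[a, b] (EFin \o horner q).
Proof.
apply: continuous_compact_integrable; first exact: segment_compact.
by apply: continuous_subspaceT => x; exact: continuous_horner.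
Qed.

Lemma pint_is_linear a b : scalar (pint a b).
Proof.
move=> c p q; rewrite /pint.
under eq_Rintegral do rewrite hornerD hornerZ.
rewrite RintegralD//=.
- by rewrite RintegralZl//; exact: integrable_horner.
- rewrite -[X in _.-integrable _ X]/(EFin \o _).
  by under [X in EFin \o X]funext do rewrite -hornerZ; exact: integrable_horner.
- exact: integrable_horner.
Qed.

HB.instance Definition _ a b :=
  GRing.isLinear.Build R {poly R} R *%R (pint a b) (pint_is_linear a b).

(** If q were non-zero, the vanishing integral of |q| would place [a, b] inside the union of a null
    set and the finitely many roots of q, against its positive length. *)
Lemma pint_ge0_eq0 a b q : a < b -> {in `[a, b], forall t, 0 <= q.[t]} ->
  pint a b q = 0 -> q = 0.
Proof.
move=> ab q0 int0; apply/eqP/negPn/negP => qN0.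
have mab : @measurable _ (measurableTypeR R) `[a, b]%classic.
  exact: measurable_itv.
have mq := measurable_int _ (integrable_horner a b q).
have : (\int[@lebesgue_measure R]_(t in `[a, b]) `|(q.[t])%:E| = 0)%E.
  have := integrable_fin_num mab (integrable_horner a b q).
  under eq_integral => t /set_mem/= tab do rewrite /= -[X in X%:E]ger0_norm ?q0//.
  by move=> /fineK <-; congr EFin; rewrite -[RHS]int0; congr fine;
    apply: eq_integral => t /set_mem/= tab; rewrite ger0_norm ?q0.
move/(ae_eq_integral_abs _ mab mq) => [N [mN N0 sub]].
have froots : finite_set [set t | root q t].
  apply: contrapT => /(infinite_set_fset (size q))[B Bq]; apply/negP.
  rewrite -ltnNge; apply: max_poly_roots => //; last exact: finmap.fset_uniq.
  by apply/allP => t tB; exact: Bq.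
have mroots : @measurable _ (measurableTypeR R) [set t | root q t].
  apply: countable_measurable; last exact: finite_set_countable.
  by move=> t; exact: measurable_set1.
have roots0 := countable_lebesgue_measure0 (finite_set_countable froots).
have : (@lebesgue_measure R).-negligible `[a, b]%classic.
  apply: (@negligibleS _ _ _ _ (N `|` [set t | root q t])); last first.
    by apply: negligibleU; apply/negligibleP.
  move=> t tab; have [|qt] := boolP (root q t); first by right.
  by left; apply: sub => /= /(_ tab) [/eqP]; apply/negP.
move/(measure_negligible mab).
have := lebesgue_measure_itv `[a, b]; rewrite /= lte_fin ab => ->.
rewrite -EFinB => -[] /eqP; rewrite subr_eq0 => /eqP ba.
by rewrite ba ltxx in ab.
Qed.

(** Expanding one factor [g] of w g^2 in monomials of degree below [n] turns orthogonality into a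
    vanishing integral of a non-negative polynomial; then w g^2 = 0, and [g] = 0 since polynomials
    over a field form a domain. *)
Lemma pint_mul_eq0 a b w g n : a < b -> w != 0 ->
  {in `[a, b], forall t, 0 <= w.[t]} -> (size g <= n)%N ->
  (forall s, (s < n)%N -> pint a b (w * g * 'X^s) = 0) -> g = 0.
Proof.
move=> ab w0 wge0 sg orth; apply/eqP; move: (w0) => /negPf w0F.
have : pint a b (w * g * g) = 0.
  rewrite [X in w * g * X](_ : _ = \sum_(i < n) g`_i *: 'X^i); last first.
    rewrite -[LHS]coefK poly_def (big_ord_widen n (fun i => g`_i *: 'X^i) sg).
    rewrite big_mkcond; apply: eq_bigr => i _; case: ltnP => // gi.
    by rewrite nth_default ?scale0r.
  rewrite mulr_sumr linear_sum big1// => i _.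
  by rewrite -scalerAr linearZ/= orth ?mulr0.
move/(pint_ge0_eq0 ab) => /(_ _)/eqP.
rewrite !mulf_eq0 w0F orbb; apply => t tab.
by rewrite !hornerM -mulrA mulr_ge0 ?wge0// -expr2 sqr_ge0.
Qed.

(** Both end points are roots, so q = -(X - a)(b - X) q2 with a weight that is non-negative on
    [a, b] and a cofactor with at most [n] coefficients. *)
Lemma lagrange_eq0 a b q n : a < b -> (size q <= n.+2)%N ->
  q.[a] = 0 -> q.[b] = 0 ->
  (forall s, (s < n)%N -> pint a b (q * 'X^s) = 0) -> q = 0.
Proof.
move=> ab sq qa qb orth.
have /factor_theorem[q1 q1E] : root q a by apply/eqP.
have /factor_theorem[q2 q2E] : root q1 b.
  move/eqP: qb; rewrite q1E hornerM mulf_eq0 => /orP[//|].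
  by rewrite hornerXsubC subr_eq0 gt_eqF.
have qE : q = - (('X - a%:P) * (b%:P - 'X) * q2) by rewrite q1E q2E; ring.
have w0 : ('X - a%:P) * (b%:P - 'X) != 0 :> {poly R}.
  by rewrite mulf_neq0 ?polyXsubC_eq0// -opprB oppr_eq0 polyXsubC_eq0.
suff q20 : q2 = 0 by rewrite qE q20 mulr0 oppr0.
apply: (pint_mul_eq0 (n := n) ab w0).
- move=> t; rewrite in_itv/= => /andP[at_ tb].
  by rewrite !hornerE mulr_ge0// subr_ge0.
- have [->|q20] := eqVneq q2 0; first by rewrite size_poly0.
  move: sq; rewrite q1E q2E !size_Mmonic ?monicXsubC ?mulf_neq0 ?polyXsubC_eq0//.
  by rewrite !size_XsubC; lia.
- move=> s sn; have := orth s sn; rewrite qE mulNr linearN/=.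
  by move=> /eqP; rewrite oppr_eq0 => /eqP.
Qed.

(** Double roots at both ends give the square ((X - a)(X - b))^2 as weight and use up four of the
    [n.+4] coefficients. *)
Lemma hermite_eq0 a b q n : a < b -> (size q <= n.+4)%N ->
  q.[a] = 0 -> q.[b] = 0 -> (deriv q).[a] = 0 -> (deriv q).[b] = 0 ->
  (forall s, (s < n)%N -> pint a b (q * 'X^s) = 0) -> q = 0.
Proof.
move=> ab sq qa qb dqa dqb orth.
have double_root (p : {poly R}) (c : R) : p.[c] = 0 -> (deriv p).[c] = 0 ->
    exists p1, p = p1 * ('X - c%:P) ^+ 2.
  move=> /eqP pc; have /factor_theorem[p1 ->] : root p c by [].
  rewrite derivM derivXsubC mulr1 hornerD.
  rewrite hornerM hornerXsubC subrr mulr0 add0r.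
  by move=> /eqP/factor_theorem[p2 ->]; exists p2; rewrite -mulrA expr2.
have [q1 q1E] := double_root _ _ qa dqa.
have ba : b - a != 0 by rewrite subr_eq0 gt_eqF.
(* The factor (b - a)^2 is non-zero, so the zero value and slope at b pass from [q] to [q1]. *)
have q1b : q1.[b] = 0.
  move/eqP: qb; rewrite q1E hornerM horner_exp hornerXsubC.
  by rewrite mulf_eq0 expf_eq0/= (negPf ba) orbF => /eqP.
have [q2 q2E] : exists q2, q1 = q2 * ('X - b%:P) ^+ 2.
  apply: double_root => //; move/eqP: dqb.
  rewrite q1E derivM hornerD [X in _ + X]hornerM q1b mul0r addr0.
  rewrite hornerM horner_exp hornerXsubC.
  by rewrite mulf_eq0 expf_eq0/= (negPf ba) orbF => /eqP.
pose w := (('X - a%:P) * ('X - b%:P)) ^+ 2.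
have qE : q = w * q2 by rewrite q1E q2E /w; ring.
have w0 : w != 0 by rewrite expf_neq0// mulf_neq0 ?polyXsubC_eq0.
suff q20 : q2 = 0 by rewrite qE q20 mulr0.
apply: (pint_mul_eq0 (n := n) ab w0).
- by move=> t _; rewrite horner_exp sqr_ge0.
- have [->|q20] := eqVneq q2 0; first by rewrite size_poly0.
  have wm : w \is monic by rewrite rpredX// rpredM// monicXsubC.
  move: sq; rewrite qE mulrC size_Mmonic// /w exprMn.
  rewrite size_Mmonic ?rpredX ?monicXsubC//.
    by rewrite !size_exp_XsubC; lia.
  by rewrite expf_neq0// polyXsubC_eq0.
- by move=> s sn; rewrite -qE orth.
Qed.

End PolynomialIntegral.

(** * Polynomial functions of three variables *)

Section Coordinates.
Variable R : realType.
Local Notation pt := 'rV[R]_3.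
Implicit Types (x : pt) (f : pt -> R) (m n : 'I_3) (t : R).

Lemma set_coordE x m t n : set_coord x m t 0 n = if n == m then t else x 0 n.
Proof. by rewrite mxE. Qed.

Lemma set_coord_id x m : set_coord x m (x 0 m) = x.
Proof. by apply/rowP => n; rewrite set_coordE; case: eqP => // ->. Qed.

Lemma set_coord_set_coord x m t t' :
  set_coord (set_coord x m t) m t' = set_coord x m t'.
Proof. by apply/rowP => n; rewrite !set_coordE; case: eqP. Qed.

Lemma set_coord_line x m t :
  t *: delta_mx 0 m + x = set_coord x m (t + x 0 m).
Proof.
apply/rowP => n; rewrite set_coordE !mxE eqxx /=.
by case: eqP => [->|_]; rewrite ?mulr1 ?mulr0 ?add0r.
Qed.

(** The two difference quotients coincide as functions of the increment, which reduces partial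
    derivatives to one real variable. *)
Lemma derivable_coordE f x m : derivable f x (delta_mx 0 m) =
  derivable (fun t => f (set_coord x m t)) (x 0 m) 1.
Proof.
rewrite /derivable; set F := (X in cvg (X @ _)); set F' := (X in _ = cvg (X @ _)).
suff -> : F = F' by [].
apply/funext => h; rewrite /F /F' /= set_coord_line set_coord_id.
by rewrite /GRing.scale /= mulr1.
Qed.

Lemma pderiv_coordE f x m :
  pderiv m f x = 'D_1 (fun t => f (set_coord x m t)) (x 0 m).
Proof.
rewrite /pderiv /derive; set F := (X in lim (X @ _)); set F' := (X in _ = lim (X @ _)).
suff -> : F = F' by [].
apply/funext => h; rewrite /F /F' /= set_coord_line set_coord_id.
by rewrite /GRing.scale /= mulr1.
Qed.

End Coordinates.

Section PolynomialFunctions.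
Variable R : realType.
Local Notation pt := 'rV[R]_3.
Implicit Types (x : pt) (f g p : pt -> R) (m n : 'I_3) (P S : 'I_3 -> {poly R}).

(** Derivatives, integrals along a direction and products act on these tensor products factor by
    factor, which moves the computations to one variable. *)
Definition tens P : pt -> R := fun x => \prod_m (P m).[x 0 m].

Definition upd P m (q : {poly R}) : 'I_3 -> {poly R} :=
  fun n => if n == m then q else P n.

(** Polynomials without control of the degree: closed under products, derivatives and integrals
    along a direction. Degrees are tracked by [Q] alone. *)
Definition is_polyfun f : Prop := exists s : seq (R * ('I_3 -> {poly R})),
  f = fun x => \sum_(a <- s) a.1 * tens a.2 x.

Lemma polyfun_ind (K : (pt -> R) -> Prop) : K (fun=> 0) ->
  (forall c P f, is_polyfun f -> K f -> K (fun x => c * tens P x + f x)) ->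
  forall f, is_polyfun f -> K f.
Proof.
move=> K0 KD f [s ->]; elim: s => [|[c P] s IH].
  by under eq_fun do rewrite big_nil.
by under eq_fun do rewrite big_cons; apply: KD => //; exists s.
Qed.

Lemma polyfun_tens P : is_polyfun (tens P).
Proof.
by exists [:: (1, P)]; apply/funext => x; rewrite big_seq1 mul1r.
Qed.

Lemma polyfun0 : is_polyfun (fun=> 0).
Proof. by exists [::]; apply/funext => x; rewrite big_nil. Qed.

Lemma polyfunD f g : is_polyfun f -> is_polyfun g ->
  is_polyfun (fun x => f x + g x).
Proof.
move=> [s ->] [s' ->]; exists (s ++ s').
by apply/funext => x; rewrite big_cat.
Qed.

Lemma polyfunZ c f : is_polyfun f -> is_polyfun (fun x => c * f x).
Proof.
move=> [s ->]; exists [seq (c * a.1, a.2) | a <- s]; apply/funext => x.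
by rewrite big_map mulr_sumr; apply: eq_bigr => a _; rewrite mulrA.
Qed.

Lemma polyfun_lin c f g : is_polyfun f -> is_polyfun g ->
  is_polyfun (fun x => c * f x + g x).
Proof. by move=> hf hg; apply: polyfunD => //; apply: polyfunZ. Qed.

Lemma polyfun_sum (I : Type) (s : seq I) (F : I -> pt -> R) :
  (forall i, is_polyfun (F i)) -> is_polyfun (fun x => \sum_(i <- s) F i x).
Proof.
move=> hF; elim: s => [|i s IH].
  by under eq_fun do rewrite big_nil; apply: polyfun0.
by under eq_fun do rewrite big_cons; apply: polyfunD.
Qed.

Lemma tensM P S x : tens P x * tens S x = tens (fun m => P m * S m) x.
Proof.
by rewrite /tens -big_split; apply: eq_bigr => m _; rewrite hornerM.
Qed.

Lemma polyfunM f g : is_polyfun f -> is_polyfun g ->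
  is_polyfun (fun x => f x * g x).
Proof.
move=> hf hg; elim/polyfun_ind: hf => [|c P {}f hf IH].
  by under eq_fun do rewrite mul0r; apply: polyfun0.
under eq_fun do rewrite mulrDl -mulrA; apply: polyfunD => //; apply: polyfunZ.
clear IH; elim/polyfun_ind: hg => [|c' P' {}g hg IH'].
  by under eq_fun do rewrite mulr0; apply: polyfun0.
under eq_fun do rewrite mulrDr mulrCA tensM.
by apply: polyfun_lin => //; apply: polyfun_tens.
Qed.

Lemma tens_set_coord P x m t : tens P (set_coord x m t) =
  (\prod_(n | n != m) (P n).[x 0 n]) * (P m).[t].
Proof.
rewrite /tens (bigD1 m)//= set_coordE eqxx mulrC; congr (_ * _).
by apply: eq_bigr => n /negPf nm; rewrite set_coordE nm.
Qed.

Lemma tens_upd P m q x : tens (upd P m q) x =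
  (\prod_(n | n != m) (P n).[x 0 n]) * q.[x 0 m].
Proof.
rewrite /tens (bigD1 m)//= /upd eqxx mulrC; congr (_ * _).
by apply: eq_bigr => n /negPf nm; rewrite nm.
Qed.

(** Along a coordinate line only one factor of each tensor product varies. The resulting polynomial
    in one variable gives derivability and evaluates [int_dir]. *)
Lemma polyfun_line f x m : is_polyfun f ->
  exists q : {poly R}, (fun t => f (set_coord x m t)) = horner q.
Proof.
move=> hf; elim/polyfun_ind: hf => [|c P {}f hf [q qE]].
  by exists 0; apply/funext => t; rewrite horner0.
exists ((c * \prod_(n | n != m) (P n).[x 0 n]) *: P m + q); apply/funext => t.
by rewrite tens_set_coord hornerD hornerZ mulrA -qE.
Qed.

Lemma polyfun_derivable f x m : is_polyfun f -> derivable f x (delta_mx 0 m).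
Proof.
move=> /(polyfun_line x m)[q qE]; rewrite derivable_coordE qE.
exact: derivable_horner.
Qed.

Lemma pderiv_tens m P : pderiv m (tens P) = tens (upd P m (deriv (P m))).
Proof.
apply/funext => x; rewrite pderiv_coordE tens_upd.
rewrite (_ : (fun t => _) = horner ((\prod_(n | n != m) (P n).[x 0 n]) *: P m)).
  by rewrite -derive1E -derivE derivZ hornerZ.
by apply/funext => t; rewrite tens_set_coord hornerZ.
Qed.

Lemma pderiv_lin m c f g : is_polyfun f -> is_polyfun g ->
  pderiv m (fun x => c * f x + g x) = fun x => c * pderiv m f x + pderiv m g x.
Proof.
move=> hf hg; apply/funext => x.
rewrite /pderiv deriveD; [|apply: derivableZ|]; try exact: polyfun_derivable.
by rewrite deriveZ//; exact: polyfun_derivable.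
Qed.

Lemma pderiv0 m : pderiv m (fun=> 0 : R) = fun=> 0.
Proof. by apply/funext => x; rewrite /pderiv derive_cst. Qed.

Lemma polyfun_pderiv m f : is_polyfun f -> is_polyfun (pderiv m f).
Proof.
move=> hf; elim/polyfun_ind: hf => [|c P {}f hf IH].
  by rewrite pderiv0; apply: polyfun0.
rewrite pderiv_lin//; last exact: polyfun_tens.
by apply: polyfun_lin => //; rewrite pderiv_tens; apply: polyfun_tens.
Qed.

Lemma polyfun_pderivs D f : is_polyfun f -> is_polyfun (pderivs D f).
Proof. by move=> hf; elim: D => //= m D; apply: polyfun_pderiv. Qed.

Lemma pderivs_lin D c f g : is_polyfun f -> is_polyfun g ->
  pderivs D (fun x => c * f x + g x) =
  fun x => c * pderivs D f x + pderivs D g x.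
Proof.
move=> hf hg; elim: D => //= m D ->.
by rewrite pderiv_lin//; apply: polyfun_pderivs.
Qed.

Lemma pderivs_tens D P :
  pderivs D (tens P) = tens (fun m => derivn (count_mem m D) (P m)).
Proof.
elim: D => [|m D IH] /=; first by congr tens; apply/funext => m.
rewrite IH pderiv_tens; congr tens; apply/funext => n; rewrite /upd eq_sym.
by case: eqP => [->|_]; rewrite ?add1n ?derivnS ?add0n.
Qed.

Lemma int_dir_line (G : box R) m f x q :
  (fun t => f (set_coord x m t)) = horner q ->
  int_dir G m f x = pint (G.1 0 m) (G.2 0 m) q.
Proof.
by move=> qE; rewrite /int_dir /pint; apply: eq_Rintegral => t _; rewrite -qE.
Qed.

Lemma int_dir_tens (G : box R) m P : int_dir G m (tens P) =
  tens (upd P m (pint (G.1 0 m) (G.2 0 m) (P m))%:P).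
Proof.
apply/funext => x; rewrite tens_upd hornerC -[_ * _]linearZ; apply: int_dir_line.
by apply/funext => t; rewrite tens_set_coord hornerZ.
Qed.

Lemma int_dir_lin (G : box R) m c f g : is_polyfun f -> is_polyfun g ->
  int_dir G m (fun x => c * f x + g x) =
  fun x => c * int_dir G m f x + int_dir G m g x.
Proof.
move=> hf hg; apply/funext => x.
have [q qE] := polyfun_line x m hf; have [q' q'E] := polyfun_line x m hg.
rewrite (int_dir_line _ qE) (int_dir_line _ q'E) -linearZ -linearD.
apply: int_dir_line; apply/funext => t; rewrite hornerD hornerZ.
by rewrite -qE -q'E.
Qed.

Lemma int_dir0 (G : box R) m : int_dir G m (fun=> 0) = fun=> 0.
Proof.
apply/funext => x; rewrite (@int_dir_line _ _ _ _ 0) ?linear0//.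
by apply/funext => t; rewrite horner0.
Qed.

Lemma polyfun_int_dir (G : box R) m f : is_polyfun f -> is_polyfun (int_dir G m f).
Proof.
move=> hf; elim/polyfun_ind: hf => [|c P {}f hf IH].
  by rewrite int_dir0; apply: polyfun0.
rewrite int_dir_lin//; last exact: polyfun_tens.
by apply: polyfun_lin => //; rewrite int_dir_tens; apply: polyfun_tens.
Qed.

Lemma foldr_int_dir_lin (G : box R) (s : seq 'I_3) c f g :
  is_polyfun f -> is_polyfun g ->
  foldr (int_dir G) (fun x => c * f x + g x) s =
  fun x => c * foldr (int_dir G) f s x + foldr (int_dir G) g s x.
Proof.
move=> hf hg; elim: s => //= m s ->.
suff polyfun_foldr h : is_polyfun h -> is_polyfun (foldr (int_dir G) h s).
  by rewrite int_dir_lin//; apply: polyfun_foldr.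
by move=> hh; elim: s => //= m' s; apply: polyfun_int_dir.
Qed.

Lemma int_box_lin (G : box R) (s : seq 'I_3) c f g :
  is_polyfun f -> is_polyfun g ->
  int_box G s (fun x => c * f x + g x) = c * int_box G s f + int_box G s g.
Proof. by move=> hf hg; rewrite /int_box foldr_int_dir_lin. Qed.

(** Integration along a direction makes its factor constant; a repeated direction would multiply by
    the side length again, whence [uniq]. The other factors are evaluated at the lower corner of
    [G]. *)
Lemma int_box_tens (G : box R) (s : seq 'I_3) P : uniq s ->
  int_box G s (tens P) = \prod_m
    (if m \in s then pint (G.1 0 m) (G.2 0 m) (P m) else (P m).[G.1 0 m]).
Proof.
move=> us; rewrite /int_box.
rewrite (_ : foldr _ _ s = tens (fun m =>
    if m \in s then (pint (G.1 0 m) (G.2 0 m) (P m))%:P else P m)).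
  by apply: eq_bigr => m _; case: ifP; rewrite ?hornerC.
elim: s us => //= m s IH /andP[ms us]; rewrite IH// int_dir_tens.
congr tens; apply/funext => n; rewrite /upd inE.
by case: eqP => [->|//]; rewrite (negPf ms).
Qed.

Lemma moment_linl (G : box R) r c f g p :
  is_polyfun f -> is_polyfun g -> is_polyfun p ->
  moment G r (fun x => c * f x + g x) p = c * moment G r f p + moment G r g p.
Proof.
move=> hf hg hp; rewrite /moment pderivs_lin//.
under eq_fun do rewrite mulrDl -mulrA.
by rewrite int_box_lin//; apply: polyfunM => //; apply: polyfun_pderivs.
Qed.

Lemma moment_linr (G : box R) r c f p p' :
  is_polyfun f -> is_polyfun p -> is_polyfun p' ->
  moment G r f (fun x => c * p x + p' x) = c * moment G r f p + moment G r f p'.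
Proof.
move=> hf hp hp'; rewrite /moment.
under eq_fun do rewrite mulrDr mulrCA.
by rewrite int_box_lin//; apply: polyfunM => //; apply: polyfun_pderivs.
Qed.

Lemma moment_tens (G : box R) r P S : uniq (unzip1 r.2) ->
  moment G r (tens P) (tens S) = \prod_m
    let q := derivn (count_mem m r.1) (P m) * S m in
    if m \in unzip1 r.2 then pint (G.1 0 m) (G.2 0 m) q else q.[G.1 0 m].
Proof.
move=> ur; rewrite /moment pderivs_tens.
by under eq_fun do rewrite tensM; apply: int_box_tens.
Qed.

End PolynomialFunctions.

(** * Tensor products of functionals *)

Section Tensor.
Variable R : realType.
Implicit Types (q : {poly R}) (l : {poly R} -> R).

Lemma scalar_sum l n (c : nat -> R) : scalar l ->
  l (\sum_(a < n) c a *: 'X^a) = \sum_(a < n) c a * l 'X^a.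
Proof.
move=> ls; have l0 : l 0 = 0.
  have := ls (-1) 0 0; rewrite scaler0 addr0 mulN1r => /eqP.
  by rewrite eq_sym addNr => /eqP.
elim: n => [|n IH]; first by rewrite !big_ord0.
by rewrite !big_ord_recr/= addrC ls IH addrC.
Qed.

(** For linear functionals this says that [mu] lies in the span of [L] on polynomials of size at
    most [n]. The form through kernels is the one that the one-dimensional lemmas deliver. *)
Definition determines n (L : ({poly R} -> R) -> Prop) (mu : {poly R} -> R) :=
  forall q, (size q <= n)%N -> (forall l, L l -> l q = 0) -> mu q = 0.

Lemma determines_sum n L mu (c : nat -> R) : determines n L mu ->
  scalar mu -> (forall l, L l -> scalar l) ->
  (forall l, L l -> \sum_(a < n) c a * l 'X^a = 0) ->
  \sum_(a < n) c a * mu 'X^a = 0.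
Proof.
move=> dL smu sL H; rewrite -scalar_sum//; apply: dL.
  by rewrite -poly_def size_poly.
by move=> l Ll; rewrite scalar_sum; [exact: H|exact: sL].
Qed.

(** [T l0 l1 l2] is the tensor product of the functionals applied to the polynomial with
    coefficients [c]. Freezing two of them leaves a polynomial in one variable, so each [mu] can be
    exchanged for members of its [L], one direction at a time and the last direction first. *)
Lemma determines_tensor n0 n1 n2 L0 L1 L2 mu0 mu1 mu2 (c : nat -> nat -> nat -> R) :
  determines n0 L0 mu0 -> determines n1 L1 mu1 -> determines n2 L2 mu2 ->
  scalar mu0 -> scalar mu1 -> scalar mu2 ->
  (forall l, L0 l -> scalar l) -> (forall l, L1 l -> scalar l) ->
  (forall l, L2 l -> scalar l) ->
  let T l0 l1 l2 := \sum_(a0 < n0) \sum_(a1 < n1) \sum_(a2 < n2)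
    c a0 a1 a2 * (l0 'X^a0 * l1 'X^a1 * l2 'X^a2) in
  (forall l0 l1 l2, L0 l0 -> L1 l1 -> L2 l2 -> T l0 l1 l2 = 0) ->
  T mu0 mu1 mu2 = 0.
Proof.
move=> d0 d1 d2 s0 s1 s2 sL0 sL1 sL2 T H.
have T0 l0 l1 l2 : T l0 l1 l2 = \sum_(a0 < n0) (\sum_(a1 < n1) \sum_(a2 < n2)
    c a0 a1 a2 * (l1 'X^a1 * l2 'X^a2)) * l0 'X^a0.
  apply: eq_bigr => a0 _; rewrite mulr_suml; apply: eq_bigr => a1 _.
  by rewrite mulr_suml; apply: eq_bigr => a2 _; ring.
have T1 l0 l1 l2 : T l0 l1 l2 = \sum_(a1 < n1) (\sum_(a0 < n0) \sum_(a2 < n2)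
    c a0 a1 a2 * (l0 'X^a0 * l2 'X^a2)) * l1 'X^a1.
  rewrite /T exchange_big; apply: eq_bigr => a1 _; rewrite mulr_suml.
  apply: eq_bigr => a0 _; rewrite mulr_suml; apply: eq_bigr => a2 _; ring.
have T2 l0 l1 l2 : T l0 l1 l2 = \sum_(a2 < n2) (\sum_(a0 < n0) \sum_(a1 < n1)
    c a0 a1 a2 * (l0 'X^a0 * l1 'X^a1)) * l2 'X^a2.
  rewrite /T; under eq_bigr do rewrite exchange_big.
  rewrite exchange_big; apply: eq_bigr => a2 _; rewrite mulr_suml.
  apply: eq_bigr => a0 _; rewrite mulr_suml; apply: eq_bigr => a1 _; ring.
rewrite T2.
apply: (determines_sum (c := fun a2 => \sum_(a0 < n0) \sum_(a1 < n1) 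
    c a0 a1 a2 * (mu0 'X^a0 * mu1 'X^a1)) d2) => // l2 L2l; rewrite -T2 T1.
apply: (determines_sum (c := fun a1 => \sum_(a0 < n0) \sum_(a2 < n2)
    c a0 a1 a2 * (mu0 'X^a0 * l2 'X^a2)) d1) => // l1 L1l; rewrite -T1 T0.
apply: (determines_sum (c := fun a0 => \sum_(a1 < n1) \sum_(a2 < n2)
    c a0 a1 a2 * (l1 'X^a1 * l2 'X^a2)) d0) => // l0 L0l; rewrite -T0.
exact: H.
Qed.

End Tensor.

(** * Monomials and the spaces [Q d] *)

Section Monomials.
Variable R : realType.
Local Notation pt := 'rV[R]_3.

Lemma prod3E (F : 'I_3 -> R) : \prod_m F m = F 0 * F 1 * F 2.
Proof.
rewrite !big_ord_recl big_ord0 mulr1 mulrA.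
by congr (F _ * F _ * F _); apply: val_inj.
Qed.

Definition mon (a0 a1 a2 : nat) : pt -> R :=
  tens (fun m : 'I_3 => 'X^(nth 0%N [:: a0; a1; a2] m)).

Lemma monE a0 a1 a2 x : mon a0 a1 a2 x = x 0 0 ^+ a0 * x 0 1 ^+ a1 * x 0 2 ^+ a2.
Proof. by rewrite /mon /tens prod3E !hornerXn. Qed.

Lemma QE d (f : pt -> R) : Q d f <-> exists c : nat -> nat -> nat -> R,
  f = fun x => \sum_(a0 < nexp (bound d 0)) \sum_(a1 < nexp (bound d 1))
    \sum_(a2 < nexp (bound d 2)) c a0 a1 a2 * mon a0 a1 a2 x.
Proof.
split=> -[c cE]; exists c; first apply/funext; move=> x; rewrite cE;
  by do 3!apply: eq_bigr => ? _; rewrite monE.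
Qed.

Lemma Q_polyfun d (f : pt -> R) : Q d f -> is_polyfun f.
Proof.
move=> /QE[c ->]; do 3!apply: polyfun_sum => ?; apply: polyfunZ.
exact: polyfun_tens.
Qed.

Lemma Q_lin d k (f g : pt -> R) : Q d f -> Q d g -> Q d (fun x => k * f x + g x).
Proof.
move=> [c cE] [c' c'E]; exists (fun a0 a1 a2 => k * c a0 a1 a2 + c' a0 a1 a2) => x.
rewrite cE c'E mulr_sumr -big_split; apply: eq_bigr => a0 _ /=.
rewrite mulr_sumr -big_split; apply: eq_bigr => a1 _ /=.
rewrite mulr_sumr -big_split; apply: eq_bigr => a2 _ /=; ring.
Qed.

Lemma Q0 d : @Q R d (fun=> 0).
Proof.
by exists (fun _ _ _ => 0) => x; rewrite !big1// => ? _; rewrite !big1// => ? _;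
  rewrite !big1// => ? _; rewrite mul0r.
Qed.

Lemma Q_mon d (a0 a1 a2 : nat) : (a0 < nexp (bound d 0%R))%N ->
  (a1 < nexp (bound d 1%R))%N ->
  (a2 < nexp (bound d 2%R))%N -> Q d (mon a0 a1 a2).
Proof.
move=> h0 h1 h2; exists (fun b0 b1 b2 => ((b0 == a0) && (b1 == a1) && (b2 == a2))%:R).
move=> x; rewrite monE.
rewrite (bigD1 (Ordinal h0))//= (bigD1 (Ordinal h1))//= (bigD1 (Ordinal h2))//=.
rewrite !eqxx /= mul1r !big1 ?addr0//.
all: move=> b /negPf; rewrite -val_eqE /= => hb; rewrite ?big1// => *;
  rewrite ?big1// => *; by rewrite hb ?andbF mul0r.
Qed.

Lemma moment0l (G : box R) r p : is_polyfun p -> moment G r (fun=> 0) p = 0.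
Proof.
move=> hp; have := moment_linl G r (-1) (polyfun0 R) (polyfun0 R) hp.
by under eq_fun do rewrite mulr0 addr0; rewrite mulN1r addNr.
Qed.

Lemma momentZl (G : box R) r c f p : is_polyfun f -> is_polyfun p ->
  moment G r (fun x => c * f x) p = c * moment G r f p.
Proof.
move=> hf hp; have := moment_linl G r c hf (polyfun0 R) hp.
by under eq_fun do rewrite addr0; rewrite moment0l ?addr0.
Qed.

Lemma moment_sum (G : box R) r (I : Type) (s : seq I) (F : I -> pt -> R) p :
  (forall i, is_polyfun (F i)) -> is_polyfun p ->
  moment G r (fun x => \sum_(i <- s) F i x) p = \sum_(i <- s) moment G r (F i) p.
Proof.
move=> hF hp; elim: s => [|i s IH].
  by under eq_fun do rewrite big_nil; rewrite big_nil moment0l.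
under eq_fun do rewrite big_cons -[F i _]mul1r.
by rewrite moment_linl//; [rewrite mul1r IH big_cons|apply: polyfun_sum].
Qed.

Lemma moment_sumr (G : box R) r f (I : Type) (s : seq I) (c : I -> R)
    (F : I -> pt -> R) : is_polyfun f -> (forall i, is_polyfun (F i)) ->
  moment G r f (fun x => \sum_(i <- s) c i * F i x) =
  \sum_(i <- s) c i * moment G r f (F i).
Proof.
move=> hf hF; elim: s => [|i s IH].
  under eq_fun do rewrite big_nil; rewrite big_nil.
  have := moment_linr G r (-1) hf (polyfun0 R) (polyfun0 R).
  by under eq_fun do rewrite mulr0 addr0; rewrite mulN1r addNr.
under eq_fun do rewrite big_cons.
rewrite moment_linr//; first by rewrite IH big_cons.
by apply: polyfun_sum => j; apply: polyfunZ.
Qed.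

End Monomials.

(** * Directions and degree bounds *)

Lemma I3P (i : 'I_3) : [\/ i = 0, i = 1 | i = 2].
Proof.
by case: i => [[|[|[|//]]] hi]; [constructor 1|constructor 2|constructor 3];
  apply: val_inj.
Qed.

Lemma I3_neq (i : 'I_3) : (i + 1 == i = false) * (i + 2 == i = false) *
  (i + 1 == i + 2 = false) * (i + 2 == i + 1 = false).
Proof. by case: (I3P i) => ->. Qed.

Lemma mem_I3 (i m : 'I_3) : m \in [:: i; i + 1; i + 2].
Proof. by case: (I3P i) => ->; case: (I3P m) => ->. Qed.

Lemma uniq_I3 (i : 'I_3) : uniq [:: i; i + 1; i + 2].
Proof. by case: (I3P i) => ->. Qed.

Definition shape_bounds (k : nat) (i : 'I_3) : bounds :=
  [:: (i, k%:Z); (i + 1, k%:Z + 1); (i + 2, k%:Z + 1)].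

Lemma bound_map (b : 'I_3 -> int) (s : seq 'I_3) m :
  bound [seq (n, b n) | n <- s] m = if m \in s then b m else 0.
Proof.
elim: s => //= n s ->; rewrite inE [m == n]eq_sym.
by case: eqP => [->|].
Qed.

Lemma nexp_shape_bounds k i m :
  nexp (bound (shape_bounds k i) m) = (if m == i then k.+1 else k.+2).
Proof.
have -> : shape_bounds k i = [seq (n, if n == i then k%:Z else k%:Z + 1) |
    n <- [:: i; i + 1; i + 2]] by rewrite /= eqxx !I3_neq.
by rewrite bound_map mem_I3; case: eqP => // _; rewrite -PoszD addn1.
Qed.

Definition moment_bound (k : nat) (i m : 'I_3) : int :=
  if m == i then k%:Z - 2 else k%:Z - 3.

Lemma nexp_moment_bound k i m : (2 <= k)%N ->
  nexp (moment_bound k i m) = (if m == i then k.-1 else k.-2).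
Proof.
move=> k2; rewrite /moment_bound; case: eqP => _.
  have -> : k%:Z - 2 = k.-2 by lia.
  by case: k k2 => [|[|]].
case: (ltnP 2 k) => k3.
  have -> : k%:Z - 3 = k.-2.-1 by lia.
  by case: k {k2} k3 => [|[|[|]]].
(* For k = 2 the bound is -1 and admits no exponent, in agreement with [k.-2] = 0. *)
have -> : k = 2%N by lia.
by have -> : 2%N%:Z - 3 = Negz 0 by lia.
Qed.

(** * Traces on subboxes *)

Section Trace.
Variable R : realType.
Local Notation pt := 'rV[R]_3.
Implicit Types (T : box R) (e : position) (f p : pt -> R).

Definition end_coord T (m : 'I_3) (b : bool) : R := if b then T.2 0 m else T.1 0 m.

(** The factor along [m] of a degree of freedom: [o] is the position, [der] tells whether the
    derivative is taken, [s] is the exponent of the monomial test function. At an end point [X^s] is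
    kept for uniformity; there [s] will be 0. *)
Definition dof1 T m (o : option bool) (der : bool) (s : nat) (q : {poly R}) : R :=
  if o is Some b then (derivn der q * 'X^s).[end_coord T m b]
  else pint (T.1 0 m) (T.2 0 m) (derivn der q * 'X^s).

Lemma dof1_scalar T m o der s : scalar (dof1 T m o der s).
Proof.
move=> c q q'; rewrite /dof1.
have -> : derivn der (c *: q + q') * 'X^s =
    c *: (derivn der q * 'X^s) + derivn der q' * 'X^s.
  by rewrite derivnD derivnZ mulrDl -scalerAl.
by case: o => [b|]; rewrite ?hornerD ?hornerZ// linearD linearZ.
Qed.

Lemma moment_dof1 T e (r : moment_type) (der : 'I_3 -> bool) (a s : 'I_3 -> nat) :
  uniq (unzip1 r.2) -> dirs e = moment_dirs r ->
  (forall m, count_mem m r.1 = der m) ->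
  moment (subbox T e) r (tens (fun m => 'X^(a m))) (tens (fun m => 'X^(s m))) =
  \prod_m dof1 T m (e m) (der m) (s m) 'X^(a m).
Proof.
move=> ur er hder; rewrite moment_tens//; apply: eq_bigr => m _ /=.
have -> : (m \in unzip1 r.2) = (e m == None).
  by have := congr1 (fun A : {set 'I_3} => m \in A) er; rewrite !inE.
rewrite hder /dof1 !mxE /end_coord.
by case: (e m) => [[]|].
Qed.

(* [o] is the position along the direction [m] of the subbox carrying the
   trace, [o'] that of a subbox of it carrying degrees of freedom. *)
Definition allowed k (i m : 'I_3) (o o' : option bool) (der : bool) (s : nat) : bool :=
  [&& (o == None) || (o' == o), der ==> (m != i) && (o' != None) &
      if o' is None then (s < nexp (moment_bound k i m))%N else s == 0%N].

(** In a degenerate direction the value at the end point is itself allowed. Otherwise the polynomial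
    vanishes, by the Lagrange case with k + 1 = (k - 1) + 2 coefficients along [i] and by the
    Hermite case with k + 2 = (k - 2) + 4 across. *)
Lemma determines_trace k T (i m : 'I_3) o x : (2 <= k)%N -> cuboid T ->
  (forall b, o = Some b -> x = end_coord T m b) ->
  determines (nexp (bound (shape_bounds k i) m))
    (fun l => exists o' der s, allowed k i m o o' der s /\ l = dof1 T m o' der s)
    (fun q : {poly R} => q.[x]).
Proof.
move=> k2 cT hx q sq H; have {}H o' der s : allowed k i m o o' der s ->
    dof1 T m o' der s q = 0 by move=> ?; apply: H; exists o', der, s.
case: o hx H => [b /(_ b erefl) -> /(_ (Some b) false 0%N)|_ H].
  by rewrite /allowed /= eqxx /= mulr1; apply.
suff -> : q = 0 by rewrite horner0.
have value b : q.[end_coord T m b] = 0.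
  by have /= := H (Some b) false 0%N; rewrite mulr1; apply.
have orth s : (s < nexp (moment_bound k i m))%N ->
    pint (T.1 0 m) (T.2 0 m) (q * 'X^s) = 0.
  by move=> hs; apply: (H None false s); rewrite /allowed hs.
move: sq orth; rewrite nexp_shape_bounds nexp_moment_bound//; case: (eqVneq m i) => mi sq.
  apply: lagrange_eq0; [exact: cT| |exact: (value false)|exact: (value true)].
  by case: k k2 sq {H} => [|[|]].
have slope b : (deriv q).[end_coord T m b] = 0.
  have := H (Some b) true 0%N; rewrite /allowed/= mi eqxx mulr1; exact.
apply: hermite_eq0; [exact: cT| |exact: (value false)|exact: (value true)|
  exact: (slope false)|exact: (slope true)].
by case: k k2 sq {H} => [|[|]].
Qed.

(** The subbox at [e] is a vertex, edge or face of the subbox at [e0], or that subbox itself. *)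
Definition refines e e0 := forall m, e0 m = None \/ e m = e0 m.

(* The one-dimensional choices [e], [der] made in each direction combine to a
   listed moment type, or to a vertex derivative when [d] is empty. *)
Lemma moment_type_of k (i : 'I_3) e (der : 'I_3 -> bool) :
  (forall m, der m -> m != i /\ e m != None) ->
  let D := [seq m <- [:: i + 1; i + 2] | der m] in
  let d := [seq (m, moment_bound k i m) | m <- [:: i; i + 1; i + 2] & e m == None] in
  [/\ D \in transverse_derivs i, uniq (unzip1 d), dirs e = moment_dirs (D, d),
      (forall m, count_mem m D = der m) &
      d = [::] \/ (D, d) \in moments k i].
Proof.
move=> hder D d.
have dE : unzip1 d = [seq m <- [:: i; i + 1; i + 2] | e m == None].
  by rewrite /unzip1 -map_comp map_id.
split.
- by rewrite /D /transverse_derivs /=; do 2!case: ifP => _; rewrite !inE !eqxx ?orbT.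
- by rewrite dE filter_uniq// uniq_I3.
- by apply/setP => m; rewrite !inE dE mem_filter mem_I3 andbT.
- move=> m; have hi : der i = false by apply/negP => /hder[/eqP].
  rewrite count_uniq_mem ?filter_uniq//; last by have /andP[] := uniq_I3 i.
  rewrite mem_filter; case hm : (der m) => //=.
  have := mem_I3 i m; rewrite inE; case: eqP => [mi|_ /= -> //].
  by rewrite mi hi in hm.
- have hi : der i = false by apply/negP => /hder[/eqP].
  have h1 := hder (i + 1); have h2 := hder (i + 2).
  rewrite /d /D /=.
  case: (e i == None); case: (e (i + 1) == None) h1; case: (e (i + 2) == None) h2;
  case: (der (i + 1)); case: (der (i + 2)) => h2 h1;
  try (by have [] := h1 isT); try (by have [] := h2 isT); try (by left);
  right; rewrite /moments /edge_moments /face_moments /cell_moments /=;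
  rewrite /moment_bound ?eqxx ?I3_neq !inE !eqxx ?orbT //.
Qed.

(** Evaluation at [x] is a tensor product of one-dimensional evaluations, each determined by the
    allowed functionals; by [moment_type_of] a product of allowed functionals is a listed degree of
    freedom on a subbox refining [e0]. Only the degenerate coordinates of [x] are prescribed,
    because polynomials are determined beyond the cell. *)
Lemma trace_eq0 k (i : 'I_3) T e0 f (x : pt) : (2 <= k)%N -> cuboid T ->
  Q (shape_bounds k i) f ->
  (forall v D, refines v e0 -> dirs v = finset.set0 -> D \in vertex_derivs i ->
    pderivs D f (subbox T v).1 = 0) ->
  (forall e r p, refines e e0 -> dirs e = moment_dirs r -> r \in moments k i ->
    Q r.2 p -> moment (subbox T e) r f p = 0) ->
  (forall m, e0 m <> None -> x 0 m = (subbox T e0).1 0 m) ->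
  f x = 0.
Proof.
move=> k2 cT Qf Hv Hm hx.
have [c fE] := (QE _ _).1 Qf.
have hxo m b : e0 m = Some b -> x 0 m = end_coord T m b.
  by move=> eb; rewrite hx ?eb// mxE eb /end_coord; case: b {eb}.
have -> : f x = \sum_(a0 < nexp (bound (shape_bounds k i) 0))
    \sum_(a1 < nexp (bound (shape_bounds k i) 1)) \sum_(a2 < nexp (bound (shape_bounds k i) 2))
    c a0 a1 a2 * (('X^a0).[x 0 0] * ('X^a1).[x 0 1] * ('X^a2).[x 0 2]).
  by rewrite fE; do 3!apply: eq_bigr => ? _; rewrite monE !hornerXn.
have dt m := @determines_trace k T i m (e0 m) (x 0 m) k2 cT (hxo m).
apply: (determines_tensor (dt 0) (dt 1) (dt 2));
  try (by move=> ? ? ?; rewrite hornerD hornerZ);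
  try (by move=> l [? [? [? [_ ->]]]]; exact: dof1_scalar).
move=> l0 l1 l2 [p0 [b0 [s0 [h0 ->]]]] [p1 [b1 [s1 [h1 ->]]]] [p2 [b2 [s2 [h2 ->]]]].
pose e : position := [ffun m : 'I_3 => nth None [:: p0; p1; p2] m].
pose der (m : 'I_3) := nth false [:: b0; b1; b2] m.
pose s (m : 'I_3) := nth 0%N [:: s0; s1; s2] m.
have {h0 h1 h2} h m : allowed k i m (e0 m) (e m) (der m) (s m).
  by rewrite ffunE; case: (I3P m) => ->.
have he : refines e e0.
  by move=> m; have /and3P[/orP[]/eqP ->] := h m; [left|right].
have hder m : der m -> m != i /\ e m != None.
  by move=> dm; have /and3P[_ /implyP/(_ dm)/andP[]] := h m.
have [DT ud ed cD rm] := moment_type_of k hder.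
move: DT ud ed cD rm; set D := (X in (X, _)); set d := (X in (_, X)) => DT ud ed cD rm.
rewrite -/d in ud rm; rewrite -/D in DT cD.
have bd m : bound d m = if e m == None then moment_bound k i m else 0.
  by rewrite bound_map mem_filter mem_I3 andbT.
(* In a degenerate direction [s m] is 0 and the default bound 0 leaves exactly that exponent. *)
have Qs : Q d (tens (fun m => 'X^(s m)) : pt -> R).
  have hs m : (s m < nexp (bound d m))%N.
    by have /and3P[_ _] := h m; rewrite bd; case: (e m) => [? /eqP ->|].
  rewrite (_ : tens _ = mon (s 0) (s 1) (s 2)); first exact: Q_mon.
  by congr tens; apply/funext => m; case: (I3P m) => ->.
(* Expanding [f] in monomials identifies the product functional with a moment against the monomial
   with exponents [s]. *)
transitivity (moment (subbox T e) (D, d) f (tens (fun m => 'X^(s m)))).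
  have pm a0 a1 a2 : is_polyfun (mon a0 a1 a2 : pt -> R) by apply: polyfun_tens.
  have ps := polyfun_tens (fun m : 'I_3 => 'X^(s m) : {poly R}).
  have pcm a0 a1 a2 : is_polyfun (fun x => c a0 a1 a2 * mon a0 a1 a2 x).
    exact: polyfunZ.
  rewrite fE moment_sum//; last by move=> ?; do 2!apply: polyfun_sum => ?.
  apply: eq_bigr => a0 _; rewrite moment_sum//; last first.
    by move=> ?; apply: polyfun_sum.
  apply: eq_bigr => a1 _; rewrite moment_sum//; apply: eq_bigr => a2 _.
  by rewrite momentZl// /mon (@moment_dof1 T e (D, d) der _ _ ud ed cD) prod3E !ffunE.
(* With no free direction there is nothing to integrate: the moment is a derivative at a vertex
   times the value of the test function. *)
case: rm => [d0|]; last by move=> rm; apply: Hm.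
rewrite /moment d0 /int_box /=.
rewrite Hv ?mul0r//.
by rewrite ed d0; apply/setP => m; rewrite !inE.
Qed.

End Trace.

(** * Unisolvence *)

Section MonomialBasis.
Variable R : realType.
Local Notation pt := 'rV[R]_3.

Definition exponents (d : bounds) : finType :=
  ('I_(nexp (bound d 0)) * 'I_(nexp (bound d 1)) * 'I_(nexp (bound d 2)))%type.

Definition monx d (a : exponents d) : pt -> R := mon a.1.1 a.1.2 a.2.

Lemma sum_monx d (c : nat -> nat -> nat -> R) (x : pt) :
  \sum_(a : exponents d) c a.1.1 a.1.2 a.2 * monx a x =
  \sum_(a0 < nexp (bound d 0)) \sum_(a1 < nexp (bound d 1))
    \sum_(a2 < nexp (bound d 2)) c a0 a1 a2 * mon a0 a1 a2 x.
Proof.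
rewrite pair_bigA /=.
by rewrite (pair_bigA _ (fun (p : 'I_(nexp (bound d 0)) * 'I_(nexp (bound d 1)))
  (a2 : 'I_(nexp (bound d 2))) =>
  c p.1 p.2 a2 * mon p.1 p.2 a2 x)).
Qed.

Lemma Q_monx d (a : exponents d) : Q d (monx a).
Proof. exact: Q_mon. Qed.

Lemma Q_sum_monx d (f : pt -> R) : Q d f ->
  exists c : exponents d -> R, f = fun x => \sum_a c a * monx a x.
Proof.
move=> /QE[c ->]; exists (fun a : exponents d => c a.1.1 a.1.2 a.2); apply/funext => x.
by rewrite sum_monx.
Qed.

Lemma Q_sum d (I : Type) (s : seq I) (c : I -> R) (F : I -> pt -> R) :
  (forall i, Q d (F i)) -> Q d (fun x => \sum_(i <- s) c i * F i x).
Proof.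
move=> QF; elim: s => [|i s IH].
  by under eq_fun do rewrite big_nil; apply: Q0.
by under eq_fun do rewrite big_cons; apply: Q_lin.
Qed.

Lemma horner_eq0 (q : {poly R}) : (forall t, q.[t] = 0) -> q = 0.
Proof.
move=> q0; apply: (@pint_ge0_eq0 _ 0 1) => // [t _|]; first by rewrite q0.
by rewrite /pint; under eq_Rintegral do rewrite q0; rewrite Rintegral_cst// mul0r.
Qed.

(** Extraction of one coefficient is determined by point evaluations in each variable, hence by
    [determines_tensor] also in three. *)
Lemma monx_free d (c : exponents d -> R) :
  (forall x : pt, \sum_a c a * monx a x = 0) -> forall a, c a = 0.
Proof.
move=> H [[b0 b1] b2].
(* Extension by zero from bounded exponents to all naturals, the form of coefficients in
   [determines_tensor]. *)
pose c' a0 a1 a2 := if (insub a0, insub a1, insub a2) is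
  (Some i0, Some i1, Some i2) then c (i0, i1, i2) else 0.
have c'E (a : exponents d) : c' a.1.1 a.1.2 a.2 = c a.
  by case: a => [[a0 a1] a2]; rewrite /c' !valK.
have dt n b : determines n (fun l => exists t, l = fun q => q.[t])
    (fun q : {poly R} => q`_b).
  move=> q _ q0; rewrite (horner_eq0 (q := q)) ?coef0// => t.
  by apply: (q0 (fun q => q.[t])); exists t.
have key : \sum_(a0 < nexp (bound d 0)) \sum_(a1 < nexp (bound d 1))
    \sum_(a2 < nexp (bound d 2)) c' a0 a1 a2 *
    (('X^a0 : {poly R})`_b0 * ('X^a1 : {poly R})`_b1 * ('X^a2 : {poly R})`_b2) = 0.
  apply: (determines_tensor (dt _ b0) (dt _ b1) (dt _ b2));
  try (by move=> ? ? ?; rewrite coefD coefZ);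
  try (by move=> l [? ->] ? ? ?; rewrite hornerD hornerZ).
  move=> l0 l1 l2 [t0 ->] [t1 ->] [t2 ->].
  have := H (\row_m nth 0 [:: t0; t1; t2] m).
  under eq_bigr do rewrite -c'E.
  rewrite sum_monx => E; rewrite -[RHS]E; do 3!apply: eq_bigr => ? _.
  by rewrite monE !hornerXn !mxE.
rewrite -[RHS]key (bigD1 b0)//= (bigD1 b1)//= (bigD1 b2)//= !coefXn !eqxx !mulr1.
rewrite [X in X + _ + _ + _](c'E (b0, b1, b2)).
rewrite !big1 ?addr0// => a /negPf; rewrite -val_eqE /= eq_sym => ab;
  rewrite ?big1// => *; rewrite ?big1// => *; by rewrite !coefXn ab ?(mul0r, mulr0).
Qed.

Lemma card_exponents d : #|exponents d| = (\prod_m nexp (bound d m))%N.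
Proof.
rewrite !card_prod !card_ord !big_ord_recl big_ord0 muln1 mulnA.
by congr (nexp (bound d _) * nexp (bound d _) * nexp (bound d _))%N; apply: val_inj.
Qed.

(** The change of basis matrices between [b] and the monomials are inverse to each other on both
    sides, which gives both inequalities between the sizes. *)
Lemma size_basis_Q d (b : seq (pt -> R)) : is_basis setT (Q d) b ->
  size b = (\prod_m nexp (bound d m))%N.
Proof.
move=> [bQ bB]; rewrite -card_exponents.
have /choice[A AE] : forall n : 'I_(size b), exists c : exponents d -> R,
    nth (fun=> 0) b n = fun x => \sum_a c a * monx a x.
  by move=> n; apply: Q_sum_monx; apply: bQ.
have /choice[C CE] : forall a : exponents d, exists c : 'rV[R]_(size b),
    forall x, monx a x = \sum_(n < size b) c 0 n * nth (fun=> 0) b n x.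
  by move=> a; have [c [cE _]] := bB _ (Q_monx a); exists c => x; apply: cE.
pose MA := \matrix_(n < size b, a < #|exponents d|) A n (enum_val a).
pose MC := \matrix_(a < #|exponents d|, n < size b) C (enum_val a) 0 n.
have sumE (F : exponents d -> R) : \sum_(a < #|exponents d|) F (enum_val a) = \sum_a F a.
  rewrite [RHS](reindex (fun a : 'I_#|exponents d| => enum_val a))//.
  by apply: onW_bij; apply: enum_val_bij.
have CA : MC *m MA = 1%:M.
  apply/matrixP => a a'; rewrite !mxE; apply/eqP; rewrite -subr_eq0; apply/eqP.
  under eq_bigr do rewrite !mxE.
  rewrite -(inj_eq enum_val_inj); move: (enum_val a) (enum_val a') => {a a'} e e'.
  apply: (monx_free (c := fun e' =>
    \sum_n C e 0 n * A n e' - (e == e')%:R)) => x; under eq_bigr do rewrite mulrBl.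
  rewrite sumrB [X in _ - X](bigD1 e)//= eqxx mul1r.
  rewrite [X in _ - (_ + X)]big1 ?addr0; last first.
    by move=> c'; rewrite eq_sym => /negPf ->; rewrite mul0r.
  under eq_bigr do rewrite mulr_suml.
  rewrite exchange_big/= [X in _ - X](CE e x); apply/eqP; rewrite subr_eq0; apply/eqP.
  apply: eq_bigr => n _; rewrite AE mulr_sumr.
  by apply: eq_bigr => c' _; rewrite mulrA.
(* Row [n] of the product and row [n] of the identity both hold coordinates of the [n]-th basis
   function in [b]; these are unique. *)
have AC : MA *m MC = 1%:M.
  apply/row_matrixP => n; have [c [_ cU]] := bB _ (bQ n (ltn_ord n)).
  transitivity c; [apply/esym|]; apply: cU => x _; last first.
    rewrite (bigD1 n)//= !mxE eqxx mul1r big1 ?addr0// => n' /negPf nn'.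
    by rewrite !mxE eq_sym nn' mul0r.
  rewrite AE -sumE; under [RHS]eq_bigr do rewrite !mxE mulr_suml.
  rewrite exchange_big; apply: eq_bigr => a _ /=; rewrite CE mulr_sumr.
  by apply: eq_bigr => n' _; rewrite !mxE mulrA.
by apply/eqP; rewrite eqn_leq (mulmx1_min AC) (mulmx1_min CA).
Qed.

End MonomialBasis.

(** * Square linear systems: from injectivity to a basis of the dual *)

Section SquareSystem.
Variables (R : realType) (J : finType).
Local Notation pt := 'rV[R]_3.
Variables (X : set (pt -> pt)) (v : J -> pt -> pt) (L : seq ((pt -> pt) -> R)).
Hypothesis XE : forall u, X u <-> exists c : J -> R, u = fun x => \sum_j c j *: v j x.

Lemma span_lin a u w : X u -> X w -> X (fun x => a *: u x + w x).
Proof.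
move=> /XE[c ->] /XE[c' ->]; apply/XE; exists (fun j => a * c j + c' j).
apply/funext => x; rewrite scaler_sumr -big_split; apply: eq_bigr => j _ /=.
by rewrite scalerDl scalerA.
Qed.

Lemma span_gen j : X (v j).
Proof.
apply/XE; exists (fun j' => (j' == j)%:R); apply/funext => x.
rewrite (bigD1 j)//= eqxx scale1r big1 ?addr0// => j' /negPf ->.
by rewrite scale0r.
Qed.

Lemma dual_space_sum phi (c : J -> R) : dual_space X phi ->
  phi (fun x => \sum_j c j *: v j x) = \sum_j c j * phi (v j).
Proof.
move=> dphi.
have X0 : X (fun=> 0).
  apply/XE; exists (fun=> 0); apply/funext => x.
  by rewrite big1// => j _; rewrite scale0r.
suff : forall s : seq J, X (fun x => \sum_(j <- s) c j *: v j x) /\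
    phi (fun x => \sum_(j <- s) c j *: v j x) = \sum_(j <- s) c j * phi (v j).
  by move=> /(_ (index_enum J))[].
elim=> [|j s [Xs phis]].
  under eq_fun do rewrite big_nil; rewrite big_nil; split=> //.
  have := dphi (-1) _ _ X0 X0; under eq_fun do rewrite scaler0 addr0.
  by rewrite mulN1r addNr.
under eq_fun do rewrite big_cons; rewrite big_cons; split.
  by apply: span_lin => //; apply: span_gen.
by rewrite dphi ?phis//; apply: span_gen.
Qed.

Lemma unisolvent_of_injective : #|J| = size L ->
  (forall c : J -> R, (forall x, \sum_j c j *: v j x = 0) -> forall j, c j = 0) ->
  (forall n, (n < size L)%N -> dual_space X (nth (fun=> 0) L n)) ->
  (forall u, X u -> (forall n, (n < size L)%N -> nth (fun=> 0) L n u = 0) ->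
    forall x, u x = 0) ->
  unisolvent X L.
Proof.
move=> cJ free dual inj; split; first exact: dual.
move=> phi dphi.
pose g (n : 'I_(size L)) : J := enum_val (cast_ord (esym cJ) n).
have bg : bijective g.
  apply: (@Bijective _ _ _ (fun j => cast_ord cJ (enum_rank j))) => n.
    by rewrite /g enum_valK cast_ordKV.
  by rewrite /g cast_ordK enum_rankK.
have sumg (V : nmodType) (F : J -> V) : \sum_j F j = \sum_n F (g n).
  by rewrite (reindex g)//; apply: onW_bij.
pose M := \matrix_(n < size L, l < size L) nth (fun=> 0) L l (v (g n)).
(* A row vector killed by [M] is a combination of generators on which all functionals vanish; it is
   zero as a field, and its coefficients are zero by freeness. *)
have uM : M^T \in unitmx.
  rewrite unitmx_tr -row_free_unit -kermx_eq0; apply/rowV0P => w /sub_kermxP wM.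
  case: bg => h gK hK.
  apply/rowP => n; rewrite mxE -(gK n).
  apply: (free (fun j => w 0 (h j))) => x.
  apply: (inj (fun x => \sum_j w 0 (h j) *: v j x)).
    by apply/XE; exists (fun j => w 0 (h j)).
  move=> l hl; rewrite dual_space_sum; last exact: dual.
  have := congr1 (fun A : 'rV_(size L) => A 0 (Ordinal hl)) wM; rewrite !mxE.
  by move=> E; rewrite -[RHS]E sumg; apply: eq_bigr => n' _; rewrite !mxE gK.
(* Existence and uniqueness of the coordinates of [phi] are both read off from this equivalence. *)
have solE (c : 'rV_(size L)) :
    (forall u, X u -> phi u = \sum_(n < size L) c 0 n * nth (fun=> 0) L n u) <->
    c *m M^T = \row_n phi (v (g n)).
  split=> [cE|cM u].
    apply/rowP => n; rewrite !mxE cE; last exact: span_gen.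
    by apply: eq_bigr => l _; rewrite !mxE.
  have phiE j : phi (v j) = \sum_(n < size L) c 0 n * nth (fun=> 0) L n (v j).
    case: bg => h gK hK; rewrite -(hK j).
    have := congr1 (fun A : 'rV_(size L) => A 0 (h j)) cM; rewrite !mxE => <-.
    by apply: eq_bigr => l _; rewrite !mxE.
  move=> /XE[a ->]; rewrite dual_space_sum//.
  under eq_bigr do rewrite phiE mulr_sumr.
  rewrite exchange_big; apply: eq_bigr => l _ /=.
  rewrite dual_space_sum; last exact: dual.
  by rewrite mulr_sumr; apply: eq_bigr => j _; rewrite mulrCA.
exists ((\row_n phi (v (g n))) *m invmx M^T); split.
  by apply/solE; rewrite mulmxKV.
by move=> c /solE <-; rewrite mulmxK.
Qed.

End SquareSystem.

(** * Properties of all members of nested lists *)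

Section AllProp.
Variables (A : Type) (K : A -> Prop).

(** The recursive conjunction follows concatenation, flattening and mapping, the operations from
    which [dofs] is built. *)
Definition allProp (s : seq A) : Prop := foldr (fun a P => K a /\ P) True s.

Lemma allProp_nth x0 s :
  allProp s <-> forall n, (n < size s)%N -> K (nth x0 s n).
Proof.
elim: s => [|a s IH]; first by split.
split=> [[Ka /IH Ks] [|n]//=|H]; first exact: Ks.
by split; [exact: (H 0%N)|apply/IH => n; exact: (H n.+1)].
Qed.

Lemma allProp_cat s s' : allProp (s ++ s') <-> allProp s /\ allProp s'.
Proof. by elim: s => [|a s IH] /=; [split=> // -[]|rewrite IH; tauto]. Qed.

Lemma allProp_flatten (I : eqType) (F : I -> seq A) t :
  allProp (flatten [seq F i | i <- t]) <-> {in t, forall i, allProp (F i)}.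
Proof.
elim: t => [|i t IH] /=; first by split.
rewrite allProp_cat IH; split=> [[Fi Ft] j|H].
  by rewrite inE => /predU1P[->|/Ft].
split=> [|j jt]; first by apply: H; rewrite inE eqxx.
by apply: H; rewrite inE jt orbT.
Qed.

Lemma allProp_map (I : eqType) (F : I -> A) t :
  allProp [seq F i | i <- t] <-> {in t, forall i, K (F i)}.
Proof.
elim: t => [|i t IH] /=; first by split.
rewrite IH; split=> [[Fi Ft] j|H].
  by rewrite inE => /predU1P[->|/Ft].
split=> [|j jt]; first by apply: H; rewrite inE eqxx.
by apply: H; rewrite inE jt orbT.
Qed.

End AllProp.

(** * The degrees of freedom of one cell *)

Section Unisolvence.
Variables (R : realType) (k : nat) (T : box R).
Variable B : 'I_3 -> moment_type -> position -> seq ('rV[R]_3 -> R).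
Hypotheses (k2 : (2 <= k)%N) (cT : cuboid T).
Hypothesis basisB : forall (i : 'I_3) (r : moment_type) (e : position),
  r \in moments k i -> is_basis setT (Q r.2) (B i r e).
Local Notation pt := 'rV[R]_3.

Lemma mem_positions S (e : position) : (e \in positions S) = (dirs e == S).
Proof. by rewrite mem_filter mem_enum andbT. Qed.

Lemma dofs_allProp (K : ((pt -> pt) -> R) -> Prop) :
  allProp K (dofs k T B) <-> forall i,
    (forall D v, D \in vertex_derivs i -> dirs v = finset.set0 ->
      K (fun u => pderivs D (Defs.comp u i) (subbox T v).1)) /\
    (forall r e n, r \in moments k i -> dirs e = moment_dirs r ->
      (n < size (B i r e))%N ->
      K (fun u => moment (subbox T e) r (Defs.comp u i) (nth (fun=> 0) (B i r e) n))).
Proof.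
have mapB (F : (pt -> R) -> _) s : allProp K [seq F p | p <- s] <->
    forall n, (n < size s)%N -> K (F (nth (fun=> 0) s n)).
  rewrite (@allProp_nth _ _ (F (fun=> 0))) size_map.
  by split=> H n ns; have := H n ns; rewrite (nth_map (fun=> 0)).
rewrite allProp_flatten; split=> H i.
  have /allProp_cat[/allProp_flatten H1 /allProp_flatten H2] := H i (mem_enum _ i).
  split=> [D v /H1/allProp_map + v0|r e n /H2/allProp_flatten + er nB].
    by apply; rewrite mem_positions v0.
  by move=> /(_ e); rewrite mem_positions er eqxx => /(_ isT)/mapB; apply.
move=> _; have [H1 H2] := H i; apply/allProp_cat; split.
  apply/allProp_flatten => D Di; apply/allProp_map => v.
  by rewrite mem_positions => /eqP; exact: H1.
apply/allProp_flatten => r rk; apply/allProp_flatten => e.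
by rewrite mem_positions => /eqP er; apply/mapB => n; exact: H2.
Qed.

Lemma shape_space_polyfun u i : shape_space k u -> is_polyfun (Defs.comp u i : pt -> R).
Proof. by move=> /(_ i); exact: Q_polyfun. Qed.

Lemma comp_lin a (u w : pt -> pt) i : Defs.comp (fun x => a *: u x + w x) i =
  fun x => a * Defs.comp u i x + Defs.comp w i x.
Proof. by apply/funext => x; rewrite /Defs.comp !mxE. Qed.

Lemma moment_eq0_basis (G : box R) r f b p : is_polyfun f ->
  is_basis setT (Q r.2) b -> Q r.2 p ->
  (forall n, (n < size b)%N -> moment G r f (nth (fun=> 0) b n) = 0) ->
  moment G r f p = 0.
Proof.
move=> hf [bQ bB] Qp H; have [c [cE _]] := bB p Qp.
have -> : p = fun x => \sum_(n < size b) c 0 n * nth (fun=> 0) b n x.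
  by apply/funext => x; rewrite cE.
rewrite moment_sumr//; first by rewrite big1// => n _; rewrite H ?mulr0.
by move=> n; apply: Q_polyfun; exact: bQ.
Qed.

Lemma dofs_dual n : (n < size (dofs k T B))%N ->
  dual_space (shape_space k) (nth (fun=> 0) (dofs k T B) n).
Proof.
move: n; apply/allProp_nth/dofs_allProp => i.
split=> [D v _ _|r e n rk _ nB] a u w Xu Xw; rewrite comp_lin.
  by rewrite pderivs_lin//; apply: shape_space_polyfun.
rewrite moment_linl//; try exact: shape_space_polyfun.
by have [bQ _] := @basisB i r e rk; apply: Q_polyfun; exact: bQ.
Qed.

Lemma dofs_injective u : shape_space k u ->
  (forall n, (n < size (dofs k T B))%N -> nth (fun=> 0) (dofs k T B) n u = 0) ->
  forall x, u x = 0.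
Proof.
move=> Xu /(@allProp_nth _ (fun phi => phi u = 0))/dofs_allProp H x.
apply/rowP => i; rewrite [RHS]mxE -/(Defs.comp u i x); have [Hv Hm] := H i.
(* The position without degenerate directions is the cell itself, so [x] is arbitrary. *)
apply: (@trace_eq0 R k i T [ffun=> None]) => //.
- exact: Xu.
- by move=> v D _ v0 Di; apply: Hv.
- move=> e r p _ er rk Qp.
  apply: (moment_eq0_basis (shape_space_polyfun i Xu) (basisB e rk) Qp) => n nB.
  exact: Hm.
- by move=> m; rewrite ffunE.
Qed.

Definition shape_index : finType := {i : 'I_3 & exponents (shape_bounds k i)}.

Definition shape_gen (j : shape_index) (x : pt) : pt :=
  monx (tagged j) x *: delta_mx 0 (tag j).

Lemma sum_shape_gen (c : shape_index -> R) x i :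
  (\sum_j c j *: shape_gen j x) 0 i =
  \sum_(a : exponents (shape_bounds k i))
    c (Tagged (fun i => exponents (shape_bounds k i)) a) * monx a x.
Proof.
rewrite summxE.
pose F (i' : 'I_3) (a : exponents (shape_bounds k i')) :=
  c (Tagged (fun i => exponents (shape_bounds k i)) a) * (monx a x * (i == i')%:R).
transitivity (\sum_i' \sum_a F i' a).
  rewrite sig_big_dep/=; apply: eq_bigr => -[i' a] _.
  by rewrite /F /shape_gen !mxE eqxx.
rewrite (bigD1 i)//= [X in _ + X]big1 ?addr0.
  by apply: eq_bigr => a _; rewrite /F eqxx mulr1.
move=> i' /negPf ii'; rewrite big1// => a _.
by rewrite /F eq_sym ii' !mulr0.
Qed.

Lemma shape_spaceE (u : pt -> pt) : shape_space k u <->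
  exists c : shape_index -> R, u = fun x => \sum_j c j *: shape_gen j x.
Proof.
split=> [Xu|[c ->] i].
  have cid_i i := cid (Q_sum_monx (Xu i)).
  exists (fun j => sval (cid_i (tag j)) (tagged j)); apply/funext => x; apply/rowP => i.
  rewrite (sum_shape_gen (fun j => sval (cid_i (tag j)) (tagged j))) /=.
  by case: (cid_i i) => c /= /(congr1 (fun f : pt -> R => f x)).
rewrite -[Q _ _]/(Q (shape_bounds k i) _).
have -> : Defs.comp (fun x => \sum_j c j *: shape_gen j x) i = fun x =>
    \sum_(a : exponents (shape_bounds k i))
    c (Tagged (fun i => exponents (shape_bounds k i)) a) * monx a x.
  by apply/funext => x; apply: sum_shape_gen.
by apply: Q_sum => a; apply: Q_monx.
Qed.

Lemma shape_gen_free (c : shape_index -> R) :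
  (forall x, \sum_j c j *: shape_gen j x = 0) -> forall j, c j = 0.
Proof.
move=> H [i a]; apply: (monx_free (c := fun a => c (existT _ i a))) => x.
by rewrite -sum_shape_gen H mxE.
Qed.

Lemma moments_bounds i r : r \in moments k i ->
  uniq (unzip1 r.2) /\ r.2 = [seq (m, moment_bound k i m) | m <- unzip1 r.2].
Proof.
move=> rk; suff /allP/(_ r rk)/andP[-> /eqP] : all (fun r : moment_type =>
    uniq (unzip1 r.2) && (r.2 == [seq (m, moment_bound k i m) | m <- unzip1 r.2]))
    (moments k i) by [].
by rewrite /moments /edge_moments /face_moments /cell_moments /= /moment_bound
  !inE ?eqxx !I3_neq ?eqxx //= ![i == _]eq_sym !I3_neq.
Qed.

(** Each direction outside [S] chooses one of two end points: 8 vertices, 4 edges or 2 faces for a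
    given set of directions, and 1 cell. *)
Lemma card_dirs (S : seq 'I_3) : uniq S ->
  size (positions [set m in S]%SET) = (2 ^ (3 - size S))%N.
Proof.
move=> uS; pose F m : pred (option bool) := if m \in S then pred1 None else predC1 None.
rewrite size_filter -sum1_count big_enum_cond/= sum1_card.
rewrite (eq_card (B := family F)); last first.
  move=> e; change ((dirs e == [set m in S]%SET) = (e \in family F)).
  apply/idP/familyP => [/eqP eS m|eF]; last (apply/eqP).
    have := congr1 (fun A : {set 'I_3} => m \in A) eS; rewrite !inE /F => eSm.
    by case: ifP eSm => _; rewrite !inE => ->.
    apply/setP => m; rewrite !inE; have := eF m; rewrite /F.
    by case: ifP => _; rewrite !inE => // /negPf.
rewrite card_family foldrE big_image/=.
transitivity (\prod_(m < 3) (if m \in S then 1 else 2))%N.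
  apply: eq_bigr => m _; rewrite /F; case: ifP => _; first by rewrite card1.
  by rewrite cardC1 card_option card_bool.
rewrite (bigID (mem S))/= big1 ?mul1n; last by move=> m ->.
rewrite (eq_bigr (fun=> 2)%N); last by move=> m /negPf ->.
rewrite prod_nat_const; congr (_ ^ _)%N.
have := cardC (mem S); rewrite card_ord (card_uniqP uS) => E.
rewrite -(@addKn (size S) #|_|); congr (_ - _)%N; rewrite -[RHS]E.
by congr addn; apply: eq_card.
Qed.

Lemma dof_count i r e : r \in moments k i ->
  size (B i r e) = (\prod_(m <- unzip1 r.2) (if m == i then k.-1 else k.-2))%N.
Proof.
move=> rk; rewrite (size_basis_Q (basisB e rk)).
have [ur rE] := moments_bounds rk.
rewrite [in RHS]big_uniq// [in RHS]big_mkcond/=; apply: eq_bigr => m _.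
rewrite rE bound_map -/(unzip1 _) -rE; case: ifP => // _.
by rewrite nexp_moment_bound.
Qed.

(** For each component both counts are (k + 1)(k + 2)^2. The degrees of freedom give the expansion
    of (2 + (k - 1))(4 + (k - 2))^2, split according to which directions carry end point data and
    which carry moments. *)
Lemma size_dofs : #|shape_index| = size (dofs k T B).
Proof.
rewrite card_tagged /dofs size_flatten /shape -map_comp.
congr sumn; apply: eq_map => i; rewrite -[RHS]/(size (_ ++ _)).
rewrite card_exponents (eq_bigr _ (fun m _ => nexp_shape_bounds k i m)).
have -> : (\prod_(m < 3) (if m == i then k.+1 else k.+2) = k.+1 * k.+2 * k.+2)%N.
  rewrite !big_ord_recl big_ord0 -!val_eqE /=.
  by case: (I3P i) => -> /=; ring.
rewrite size_cat size_allpairs size_flatten sumnE !big_map.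
have momentsE : (\sum_(r <- moments k i)
      size [seq (fun u => moment (subbox T e) r (Defs.comp u i) p)
             | e <- positions (moment_dirs r), p <- B i r e] =
    \sum_(r <- moments k i) 2 ^ (3 - size (unzip1 r.2)) *
      (\prod_(m <- unzip1 r.2) (if m == i then k.-1 else k.-2)))%N.
  apply: eq_big_seq => r rk; have [ur _] := moments_bounds rk.
  rewrite size_allpairs_dep -(card_dirs ur) sumnE big_map.
  rewrite (eq_bigr _ (fun e _ => dof_count e rk)).
  by rewrite big_const_seq iter_addn_0 count_predT mulnC.
rewrite momentsE.
have -> : positions finset.set0 = positions [set m in [::]]%SET.
  by congr positions; apply/setP => m; rewrite !inE.
rewrite card_dirs// /moments /edge_moments /face_moments /cell_moments /=.
rewrite !big_cons big_nil.
rewrite /= !eqxx !I3_neq /=.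
(* Writing k = k1 + 2 removes the truncated predecessors before [ring]. *)
rewrite big_nil; case: k k2 => [|[|k1]] // _ /=.
by rewrite (_ : 3 - 0 = 3)%N// (_ : 3 - 1 = 2)%N// (_ : 3 - 2 = 1)%N//; ring.
Qed.

Lemma dofs_unisolvent : unisolvent (shape_space k) (dofs k T B).
Proof.
apply: (unisolvent_of_injective shape_spaceE size_dofs shape_gen_free).
  exact: dofs_dual.
exact: dofs_injective.
Qed.

End Unisolvence.

(** * Agreement of the traces from neighbouring cells *)

Section Gluing.
Variables (R : realType) (k : nat).
Local Notation pt := 'rV[R]_3.
Implicit Types (T : box R) (e v : position) (x : pt).

Lemma subbox_le T e m : cuboid T ->
  ((subbox T e).1 0 m < (subbox T e).2 0 m) = (e m == None).
Proof.
move=> cT; rewrite !mxE; case: (e m) => [[]|] /=; rewrite ?ltxx//.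
exact: cT.
Qed.

Lemma subbox_None T e : (forall m, e m = None) -> subbox T e = T.
Proof.
move=> eN; rewrite [RHS]surjective_pairing; congr pair;
  by apply/rowP => m; rewrite mxE eN.
Qed.

(** Sides of cuboids have positive length, so equal subboxes are degenerate in the same directions.
    The witness follows [v] in their free directions and [e'] in the others. *)
Lemma subbox_refine T T' e e' v : cuboid T -> cuboid T' ->
  subbox T e = subbox T' e' -> refines v e ->
  exists v', subbox T v = subbox T' v'.
Proof.
move=> cT cT' ee' ve.
have eN m : (e m == None) = (e' m == None).
  by rewrite -(subbox_le e m cT) ee' subbox_le.
exists [ffun m => if e m == None then v m else e' m].
have e1 m := congr1 (fun b : box R => b.1 0 m) ee'.
have e2 m := congr1 (fun b : box R => b.2 0 m) ee'.
congr pair; apply/rowP => m; move: (e1 m) (e2 m) (eN m) (ve m); rewrite !mxE ffunE;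
  case: (e m) => [b|] /=.
- by move=> E _ _ [//|->].
- by case: (e' m) => [b _ _ //|-> -> _ _].
- by move=> _ E _ [//|->].
- by case: (e' m) => [b _ _ //|-> -> _ _].
Qed.

(** The difference of the two polynomials has vanishing degrees of freedom on every subbox of the
    common one, so [trace_eq0] applies to it. *)
Lemma fe_trace_eq (w : box R -> pt -> pt) T T' e e' i x : (2 <= k)%N ->
  cuboid T -> cuboid T' -> T != T' ->
  shape_space k (w T) -> shape_space k (w T') ->
  (forall v v' i D, dirs v = finset.set0 -> subbox T v = subbox T' v' ->
     D \in vertex_derivs i ->
     pderivs D (Defs.comp (w T) i) (subbox T v).1 =
     pderivs D (Defs.comp (w T') i) (subbox T' v').1) ->
  (forall e e' i r p, subbox T e = subbox T' e' ->
     r \in edge_moments k i ++ face_moments k i -> moment_dirs r = dirs e ->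
     Q r.2 p ->
     moment (subbox T e) r (Defs.comp (w T) i) p =
     moment (subbox T' e') r (Defs.comp (w T') i) p) ->
  subbox T e = subbox T' e' -> cell (subbox T e) x -> w T x 0 i = w T' x 0 i.
Proof.
move=> k2 cT cT' TT' Xw Xw' Hv Hm ee' ex.
have pw := shape_space_polyfun i Xw; have pw' := shape_space_polyfun i Xw'.
apply/eqP; rewrite -subr_eq0 addrC -mulN1r.
apply/eqP; apply: (@trace_eq0 R k i T e
  (fun x => -1 * Defs.comp (w T') i x + Defs.comp (w T) i x) x k2 cT).
- by apply: Q_lin; [exact: Xw'|exact: Xw].
- move=> v D /(subbox_refine cT cT' ee')[v' vv'] v0 Di.
  by rewrite pderivs_lin// (Hv v v')// vv' mulN1r addNr.
- move=> e1 r p ref er rk Qp; have [e1' ee1'] := subbox_refine cT cT' ee' ref.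
  have pp := Q_polyfun Qp.
  rewrite moment_linl// (Hm _ e1')// ?ee1' ?mulN1r ?addNr//.
  (* Cell moments are not shared, but they occur only if the common subbox is the whole of both
     cells, which contradicts T != T'. *)
  move: rk; rewrite /moments catA mem_cat => /orP[//|].
  rewrite inE => /eqP rE.
  have eN m : e m = None.
    have : m \in dirs e1.
      by rewrite er rE !inE; have := mem_I3 i m; rewrite !inE.
    rewrite inE => /eqP e1m.
    by case: (ref m) => [//|<-].
  have e'N m : e' m = None.
    by apply/eqP; rewrite -(subbox_le e' m cT') -ee' subbox_le// eN.
  by case/eqP: TT'; rewrite -(subbox_None T eN) ee' subbox_None.
- move=> m em; have := ex m; rewrite !mxE.
  by case: (e m) em => [[]|//] _ /=; rewrite -eq_le => /eqP.
Qed.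

End Gluing.

(** * Lines through the mesh *)

Section MeshGeometry.
Variables (R : realType).
Local Notation pt := 'rV[R]_3.
Implicit Types (T : box R) (x : pt) (Omega : set pt) (Th : seq (box R)).

(** Provides a displacement smaller than every non-zero gap between the coordinates of a point and
    the end points of the cells. *)
Lemma exists_small (r : R) (s : seq R) : 0 < r ->
  exists e, [/\ 0 < e, e < r & {in s, forall c, c != 0 -> e < `|c|}].
Proof.
move=> r0; elim: s => [|c s [e [e0 er IH]]].
  by exists (r / 2); split=> //; lra.
have [->|c0] := eqVneq c 0.
  exists e; split=> // c'; rewrite inE => /predU1P[->|]; last exact: IH.
  by rewrite eqxx.
exists (Num.min e (`|c| / 2)); split.
- by rewrite lt_min e0 divr_gt0// normr_gt0.
- by rewrite gt_min er.
- move=> c'; rewrite inE => /predU1P[->|c's] c'0.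
    by rewrite gt_min orbC ltr_pdivrMr// ltr_pMr ?normr_gt0// ltr1n.
  by rewrite gt_min IH.
Qed.

(* The half-open intervals on which a point moved slightly downwards ([b]) or
   upwards ([~~ b]) remains in [[l, u]]. *)
Definition in_side (b : bool) (l u t : R) := if b then l < t <= u else l <= t < u.

(** The point displaced in the directions given by [s] is still in [Omega], hence in a closed cell.
    The displacement is too small to jump over an end point, so [x] lies in the half-open version of
    that cell. *)
Lemma mesh_quadrant Omega Th x (s : 'I_3 -> bool) : open Omega ->
  is_mesh Omega Th -> Omega x ->
  exists2 T, T \in Th & forall m, in_side (s m) (T.1 0 m) (T.2 0 m) (x 0 m).
Proof.
move=> oO [_ clO _ _] Ox.
have /nbhs_ballP[r /= r0 rO] : nbhs x Omega by exact: open_nbhs_nbhs.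
have [eps [e0 er sep]] := exists_small (flatten [seq [seq T.1 0 m - x 0 m |
  m <- enum 'I_3] ++ [seq T.2 0 m - x 0 m | m <- enum 'I_3] | T <- Th]) r0.
pose y : pt := \row_m (x 0 m + (if s m then - eps else eps)).
have : closure Omega y.
  apply: subset_closure; apply: rO; split=> // i m; rewrite ord1 mxE /ball /= opprD.
  by rewrite addrA subrr sub0r normrN; case: (s m); rewrite ?normrN gtr0_norm.
rewrite clO => -[T TTh Ty]; exists T => // m.
have {}sep c : c = T.1 0 m - x 0 m \/ c = T.2 0 m - x 0 m -> c != 0 -> eps < `|c|.
  move=> cE; apply: sep; apply/flattenP; eexists; first exact: (map_f _ TTh).
  rewrite mem_cat; case: cE => ->; apply/orP; [left|right];
  by apply/mapP; exists m; rewrite ?mem_enum.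
have := Ty m; rewrite mxE /in_side => /andP[ly yu].
have sl : x 0 m < T.1 0 m -> eps < T.1 0 m - x 0 m.
  rewrite -subr_gt0 => h; rewrite -[ltRHS]gtr0_norm//.
  by apply: sep; [left|rewrite gt_eqF].
have su : T.2 0 m < x 0 m -> eps < x 0 m - T.2 0 m.
  rewrite -subr_gt0 => h; rewrite -[ltRHS]gtr0_norm// distrC.
  by apply: sep; [right|rewrite -opprB oppr_eq0 gt_eqF].
move: ly yu; case: (s m) => ly yu; apply/andP; split.
- by lra.
- by case: (leP (x 0 m)) => // /su; lra.
- by case: (leP (T.1 0 m)) => // /sl; lra.
- by lra.
Qed.

(** Otherwise the intervals overlap in all three directions, and the midpoint of the overlap lies in
    both open cells. *)
Lemma mesh_separated Omega Th T T' : is_mesh Omega Th -> T \in Th -> T' \in Th ->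
  T != T' -> exists m, T.2 0 m <= T'.1 0 m \/ T'.2 0 m <= T.1 0 m.
Proof.
move=> [cTh _ disj _] TTh T'Th TT'; apply: contrapT => sep.
have {}sep m : T'.1 0 m < T.2 0 m /\ T.1 0 m < T'.2 0 m.
  by split; rewrite ltNge; apply/negP => h; apply: sep; exists m; [left|right].
pose z : pt := \row_m ((Num.max (T.1 0 m) (T'.1 0 m) + Num.min (T.2 0 m) (T'.2 0 m)) / 2).
have : (open_cell T `&` open_cell T') z.
  have zE m : (T.1 0 m < z 0 m < T.2 0 m) /\ (T'.1 0 m < z 0 m < T'.2 0 m).
    have [h1 h2] := sep m; have h3 := cTh _ TTh m; have h4 := cTh _ T'Th m.
    rewrite mxE; case: (leP (T.1 0 m) (T'.1 0 m));
      case: (leP (T.2 0 m) (T'.2 0 m)) => ? ?; split; apply/andP; split; lra.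
  by split=> m; have [] := zE m.
by rewrite disj.
Qed.

End MeshGeometry.

(** * Cancellation of end point contributions along a line *)

Section LineCancellation.
Variables (R : realType).
Local Notation pt := 'rV[R]_3.
Implicit Types (T : box R) (x : pt) (m : 'I_3).
Variables (Omega : set pt) (Th : seq (box R)) (f : box R -> pt -> R).
Hypotheses (oO : open Omega) (mesh : is_mesh Omega Th).
Hypothesis glue : forall T T' x, T \in Th -> T' \in Th -> cell T x -> cell T' x ->
  f T x = f T' x.

Definition half_open_cell (T : box R) : set pt :=
  [set x | forall m, T.1 0 m <= x 0 m < T.2 0 m].

(** The intervals are half-open across [m], so a line running inside a common face of several cells
    is attributed to only one of them. *)
Definition crosses (x : pt) (m : 'I_3) (T : box R) : bool :=
  [forall n, (n != m) ==> (T.1 0 n <= x 0 n < T.2 0 n)].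

(** The common value of the pieces, read from the first cell containing [x]; 0 is the default
    outside all cells. *)
Definition glued (x : pt) : R :=
  if [seq T <- Th | `[< cell T x >]] is T :: _ then f T x else 0.

Lemma gluedE T x : T \in Th -> cell T x -> glued x = f T x.
Proof.
move=> TTh Tx; rewrite /glued.
case E : [seq _ <- _ | _] => [|T' s].
  have : T \in [seq T <- Th | `[< cell T x >]].
    by rewrite mem_filter TTh andbT; apply/asboolP.
  by rewrite E.
have : T' \in [seq T <- Th | `[< cell T x >]] by rewrite E inE eqxx.
by rewrite mem_filter => /andP[/asboolP T'x T'Th]; apply: glue.
Qed.

Lemma crossesP x m T :
  reflect (forall n, n != m -> T.1 0 n <= x 0 n < T.2 0 n) (crosses x m T).
Proof. by apply: (iffP forallP) => H n; [move=> /(implyP (H n))|apply/implyP/H]. Qed.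

Lemma cell_set_coord x m T t : crosses x m T -> T.1 0 m <= t <= T.2 0 m ->
  cell T (set_coord x m t).
Proof.
move=> /crossesP Tx tT n; rewrite set_coordE; case: eqVneq => [->//|/Tx].
by move=> /andP[-> /ltW].
Qed.

(** In the directions across [m] the half-open intervals share a coordinate of [x], so the
    separation must take place along [m]. *)
Lemma crosses_separated x m T T' : T \in Th -> T' \in Th -> T != T' ->
  crosses x m T -> crosses x m T' -> T.2 0 m <= T'.1 0 m \/ T'.2 0 m <= T.1 0 m.
Proof.
move=> TTh T'Th TT' /crossesP Tx /crossesP T'x.
have [n] := mesh_separated mesh TTh T'Th TT'.
have [->//|nm] := eqVneq n m.
by have /andP[a b] := Tx n nm; have /andP[c d] := T'x n nm; case; lra.
Qed.

(** By [glue] the summands are increments of one function [V] on the line. Where [V] is non-zero the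
    point lies in the open set [Omega], so a cell ends there exactly if another one begins. [undup]
    counts each cell once. *)
Lemma line_cancellation (phi : pt -> R) (x : pt) (m : 'I_3) :
  (forall y, ~ Omega y -> phi y = 0) ->
  \sum_(T <- undup Th | crosses x m T)
    (f T (set_coord x m (T.2 0 m)) * phi (set_coord x m (T.2 0 m)) -
     f T (set_coord x m (T.1 0 m)) * phi (set_coord x m (T.1 0 m))) = 0.
Proof.
move=> phi0; have [cTh _ _ _] := mesh.
pose V t := glued (set_coord x m t) * phi (set_coord x m t).
pose S := [seq T <- undup Th | crosses x m T].
pose up (T : box R) := T.2 0 m; pose lo (T : box R) := T.1 0 m.
have lt T : T \in Th -> lo T < up T by move=> TTh; exact: cTh.
have memS T : (T \in S) = crosses x m T && (T \in Th).
  by rewrite mem_filter mem_undup.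
rewrite -big_filter -/S.
(* Outside the zeros of [V], the upper end points are exactly the lower ones. *)
transitivity (\sum_(T <- S) (V (up T) - V (lo T))).
  apply: eq_big_seq => T; rewrite memS => /andP[Tx TTh].
  have ll := ltW (lt T TTh); rewrite /V.
  rewrite (@gluedE T (set_coord x m (up T)))//; last first.
    by apply: cell_set_coord => //; rewrite ll lexx.
  rewrite (@gluedE T (set_coord x m (lo T)))//.
  by apply: cell_set_coord => //; rewrite ll lexx.
rewrite sumrB -(big_map up xpredT V) -(big_map lo xpredT V).
have support (s : seq R) : \sum_(t <- s) V t = \sum_(t <- [seq t <- s | V t != 0]) V t.
  rewrite big_filter [RHS]big_mkcond; apply: eq_bigr => t _.
  by case: eqP.
rewrite (support (map up S)) (support (map lo S)).
apply/eqP; rewrite subr_eq0; apply/eqP/perm_big.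
have uS : uniq S by rewrite filter_uniq// undup_uniq.
have VO t : V t != 0 -> Omega (set_coord x m t).
  by apply: contra_neqP => /phi0; rewrite /V => ->; rewrite mulr0.
have line T t : T \in Th ->
    (forall n, n != m -> T.1 0 n <= set_coord x m t 0 n < T.2 0 n) -> T \in S.
  move=> TTh H; rewrite memS TTh andbT; apply/crossesP => n nm.
  by have := H n nm; rewrite set_coordE (negPf nm).
have sepS T T' : T \in S -> T' \in S -> T != T' -> up T <= lo T' \/ up T' <= lo T.
  rewrite !memS => /andP[Tx TTh] /andP[T'x T'Th] TT'.
  exact: (crosses_separated TTh T'Th TT' Tx T'x).
have ltS T : T \in S -> lo T < up T by rewrite memS => /andP[_ /lt].
(* Two crossed cells with the same upper or the same lower end point would overlap along the
   line. *)
apply: uniq_perm.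
- rewrite filter_uniq// map_inj_in_uniq// => T T' TS T'S E.
  apply/eqP/negPn/negP => /(sepS _ _ TS T'S); have := ltS _ TS; have := ltS _ T'S; lra.
- rewrite filter_uniq// map_inj_in_uniq// => T T' TS T'S E.
  apply/eqP/negPn/negP => /(sepS _ _ TS T'S); have := ltS _ TS; have := ltS _ T'S; lra.
move=> t; rewrite !mem_filter; case Vt : (V t != 0) => //=.
have Ot := VO _ Vt.
apply/mapP/mapP => -[T TS tT].
  (* Moving upwards from the upper end of [T] leads into a crossed cell [T']; separation from [T]
     forces it to begin at [t]. *)
  have [T' T'Th H] := mesh_quadrant (fun=> false) oO mesh Ot.
  have T'S : T' \in S by apply: (line _ t) => // n _; exact: H.
  exists T' => //; have := H m; rewrite set_coordE eqxx /= => Hm.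
  have [TT'|/(sepS _ _ TS T'S)] := eqVneq T T'.
    by move: Hm; rewrite -TT' tT /up ltxx andbF.
  by have := ltS _ TS; move: tT Hm; rewrite /up /lo; lra.
(* Moving downwards along [m] only keeps the orientation required by [crosses] in the other
   directions. *)
have [T' T'Th H] := mesh_quadrant (fun n => n == m) oO mesh Ot.
have T'S : T' \in S.
  by apply: (line _ t) => // n nm; have := H n; rewrite (negPf nm).
exists T' => //; have := H m; rewrite set_coordE eqxx /= => Hm.
have [TT'|/(sepS _ _ TS T'S)] := eqVneq T T'.
  by move: Hm; rewrite -TT' tT /lo ltxx.
by have := ltS _ TS; move: tT Hm; rewrite /up /lo; lra.
Qed.

End LineCancellation.

(** * Integration in three variables *)

Section LineCalculus.
Variable R : realType.
Local Notation pt := 'rV[R]_3.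
Implicit Types (x : pt) (m : 'I_3) (F : pt -> R).

Lemma continuous_line (x d : pt) (c : R) :
  continuous (fun t : R => (t - c) *: d + x : pt).
Proof.
move=> t; apply: cvgD; last exact: cvg_cst.
by apply: cvgZr_tmp; apply: cvgB; [exact: cvg_id|exact: cvg_cst].
Qed.

Lemma continuous_set_coord x m : continuous (fun t : R => set_coord x m t : pt).
Proof.
have -> : (fun t : R => set_coord x m t : pt) =
    fun t => (t - x 0 m) *: (delta_mx 0 m : pt) + x.
  by apply/funext => t; rewrite set_coord_line subrK.
exact: continuous_line.
Qed.

Lemma continuous_funM (f g : pt -> R) : continuous f -> continuous g ->
  continuous (fun x => f x * g x).
Proof. by move=> cf cg x; exact: (cvgM (cf x) (cg x)). Qed.

Lemma continuous_funD (f g : pt -> R) : continuous f -> continuous g ->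
  continuous (fun x => f x + g x).
Proof. by move=> cf cg x; exact: (cvgD (cf x) (cg x)). Qed.

Lemma tens_continuous (P : 'I_3 -> {poly R}) : continuous (tens P).
Proof.
rewrite /tens; elim: (index_enum _) => [|m s IH].
  by under eq_fun do rewrite big_nil; exact: cst_continuous.
under eq_fun do rewrite big_cons.
apply: continuous_funM => // x.
by apply: continuous_comp; [exact: coord_continuous|exact: continuous_horner].
Qed.

Lemma polyfun_continuous F : is_polyfun F -> continuous F.
Proof.
move=> hF; elim/polyfun_ind: hF => [|c P f _ cf]; first exact: cst_continuous.
apply: continuous_funD => //; apply: continuous_funM; last exact: tens_continuous.
exact: cst_continuous.
Qed.

Lemma line_derivable F x m t : (forall y, derivable F y (delta_mx 0 m)) ->
  derivable (fun t => F (set_coord x m t)) t 1.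
Proof.
move=> /(_ (set_coord x m t)); rewrite derivable_coordE set_coordE eqxx.
by under eq_fun do rewrite set_coord_set_coord.
Qed.

Lemma line_derive F x m t :
  derive1 (fun t => F (set_coord x m t)) t = pderiv m F (set_coord x m t).
Proof.
rewrite pderiv_coordE set_coordE eqxx derive1E.
by under [in RHS]eq_fun do rewrite set_coord_set_coord.
Qed.

Lemma line_FTC F x m a b : (forall y, derivable F y (delta_mx 0 m)) ->
  continuous (pderiv m F) -> a < b ->
  (\int[@lebesgue_measure R]_(t in `[a, b]) (pderiv m F (set_coord x m t))%:E =
    (F (set_coord x m b) - F (set_coord x m a))%:E)%E.
Proof.
move=> dF cF ab; rewrite EFinB.
have dl t : derivable (fun t => F (set_coord x m t)) t 1 by exact: line_derivable.
have cl : continuous (fun t => F (set_coord x m t)).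
  by move=> t; apply/differentiable_continuous/derivable1_diffP.
apply: (@continuous_FTC2 R (fun t => pderiv m F (set_coord x m t))
  (fun t => F (set_coord x m t))) => //.
- apply: continuous_subspaceT => t.
  apply: (@continuous_comp _ _ _ (set_coord x m)); last exact: cF.
  exact: continuous_set_coord.
- split=> //; [apply: cvg_at_right_filter|apply: cvg_at_left_filter]; exact: cl.
- by move=> t _; rewrite line_derive.
Qed.

End LineCalculus.

(** * Borel measurability in three variables *)

Section Measurability.
Variable R : realType.
Local Notation pt := 'rV[R]_3.
Local Notation mR := (measurableTypeR R).
Implicit Types (U : set pt) (F : pt -> R).

Lemma point3E (z : R * R * R) :
  (point3 z 0 0 = z.1.1) * (point3 z 0 1 = z.1.2) * (point3 z 0 2 = z.2).
Proof. by rewrite !mxE. Qed.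

(** An open set is the union of the countably many half-open boxes with rational end points inside
    it. [point3] links the topology of row vectors with the product sigma-algebra. *)
Lemma open_measurable3 U : open U ->
  @measurable _ (mR * mR * mR)%type (@point3 R @^-1` U).
Proof.
move=> oU.
pose rbox (q : (rat * rat) * (rat * rat) * (rat * rat)) : set (mR * mR * mR) :=
  `]ratr q.1.1.1, ratr q.1.1.2[%classic `*` `]ratr q.1.2.1, ratr q.1.2.2[%classic
  `*` `]ratr q.2.1, ratr q.2.2[%classic.
have -> : @point3 R @^-1` U =
    \bigcup_(q in [set q | rbox q `<=` @point3 R @^-1` U]) rbox q.
  apply/seteqP; split=> [z /= Uz|z [q /= qU qz]]; last exact: qU.
  have /nbhs_ballP[e /= e0 eU] : nbhs (point3 z) U by exact: open_nbhs_nbhs.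
  have near_rat (t : R) : exists p q : rat, [/\ ratr p < t < ratr q,
      t - e < ratr p & ratr q < t + e].
    have /rat_in_itvoo[p] : t - e < t by rewrite gtrBl.
    have /rat_in_itvoo[q] : t < t + e by rewrite ltrDl.
    rewrite !in_itv /= => /andP[h1 h2] /andP[h3 h4].
    by exists p, q; split=> //; apply/andP.
  case: z Uz eU => [[x y] t] Uz eU.
  have [p1 [q1 [h1 l1 u1]]] := near_rat x.
  have [p2 [q2 [h2 l2 u2]]] := near_rat y.
  have [p3 [q3 [h3 l3 u3]]] := near_rat t.
  exists (((p1, q1), (p2, q2)), (p3, q3)); last first.
    by split; [split|]; rewrite /= in_itv.
  move=> [[x' y'] t'] /= [[/=]]; rewrite !in_itv /=.
  move=> /andP[a1 b1] /andP[a2 b2] /andP[a3 b3].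
  apply: eU; split=> // i m; rewrite ord1 /ball /= ltr_norml.
  by case: (I3P m) => ->; rewrite !point3E /=; apply/andP; split; lra.
rewrite bigcup_mkcond; apply: countable_bigcupT_measurable => [|q].
  exact: countableP.
case: ifP => // _; apply: measurableX; [apply: measurableX|]; exact: measurable_itv.
Qed.

Lemma continuous_measurable3 F : continuous F ->
  @measurable_fun _ _ (mR * mR * mR)%type mR setT (F \o @point3 R).
Proof.
move=> /continuousP cF.
apply: (measurability _ (measurable_realfun.RGenOpens.measurableE R)).
move=> _ [_ [a [b ->] <-]]; rewrite setTI.
exact: (open_measurable3 (cF _ (@interval_open _ (BRight a) (BLeft b) isT isT))).
Qed.

End Measurability.

Lemma bounded_support_integrable d (T : measurableType d) (R : realType)
    (mu : {measure set T -> \bar R}) (D : set T) (f : T -> R) (M : R) :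
  measurable D -> (mu D < +oo)%E -> measurable_fun setT f ->
  (forall z, ~ D z -> f z = 0) -> (forall z, `|f z| <= M) ->
  mu.-integrable setT (EFin \o f).
Proof.
move=> mD muD mf f0 fM.
have fD : (EFin \o f) \_ D = EFin \o f.
  by apply/funext => z; rewrite patchE; case: ifPn => // /negP; rewrite inE /= => /f0 ->.
rewrite -fD; apply/(integrable_mkcond _ mD).
apply: measurable_bounded_integrable => //; first exact: measurable_funS mf.
exists M; split; first exact: num_real.
by move=> N MN z _; apply: le_trans (ltW MN).
Qed.

(** * Fubini along coordinate lines *)

Section LineIntegrals.
Variable R : realType.
Local Notation pt := 'rV[R]_3.
Local Notation mR := (measurableTypeR R).
Local Notation mu := (@lebesgue_measure R).

Definition centered_box (M : R) : set (mR * mR * mR) :=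
  `[- M, M]%classic `*` `[- M, M]%classic `*` `[- M, M]%classic.

Lemma lebesgue_measure_segment_lty (M : R) : (mu `[(- M)%R, M]%classic < +oo)%E.
Proof.
by rewrite lebesgue_measure_itv /=; case: ifP => _; rewrite ?ltry // -EFinB ltry.
Qed.

Lemma measurable_centered_box M : measurable (centered_box M).
Proof.
by apply: measurableX; [apply: measurableX|]; exact: measurable_itv.
Qed.

Lemma measure_square_lty (M : R) :
  ((mu \x mu) (`[(- M)%R, M]%classic `*` `[(- M)%R, M]%classic) < +oo)%E.
Proof.
rewrite product_measure1E; try exact: measurable_itv.
by apply: lte_mul_pinfty; rewrite ?ge0_fin_numE ?lebesgue_measure_segment_lty.
Qed.

Lemma square_sigma_finite : sigma_finite setT (mu \x mu)%E.
Proof.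
pose I (n : nat) : set mR := `[- (n%:R : R), n%:R]%classic.
exists (fun n => I n `*` I n).
  apply/seteqP; split=> [[x y] _|//].
  exists (Num.bound (`|x| + `|y|)) => //.
  have := archi_boundP (addr_ge0 (normr_ge0 x) (normr_ge0 y)).
  have := normr_ge0 x; have := normr_ge0 y.
  by split; rewrite /I /= in_itv /= -ler_norml; lra.
move=> n; split; last exact: measure_square_lty.
by apply: measurableX; exact: measurable_itv.
Qed.

(* The library's canonical instances only see [m1 \x m2] as sigma-finite when
   both factors are subprobabilities. *)
Definition square_measure : {sigma_finite_measure set (mR * mR)%type -> \bar R} :=
  HB.pack_for {sigma_finite_measure set (mR * mR)%type -> \bar R}
    (mu \x mu)%E (Measure_isSigmaFinite.Build _ _ _ (mu \x mu)%E square_sigma_finite).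

Lemma measure_centered_box_lty (M : R) : (@mu3 R (centered_box M) < +oo)%E.
Proof.
rewrite /mu3 product_measure1E; try exact: measurable_itv.
  by apply: lte_mul_pinfty;
    rewrite ?ge0_fin_numE ?measure_square_lty ?lebesgue_measure_segment_lty.
by apply: measurableX; exact: measurable_itv.
Qed.

Lemma integral3_lines_eq0 (F : pt -> R) m M :
  @measurable_fun _ _ (mR * mR * mR)%type mR setT (F \o @point3 R) ->
  (forall z, ~ centered_box M z -> F (point3 z) = 0) ->
  (forall x, `|F x| <= M) ->
  (forall x, (\int[mu]_t (F (set_coord x m t))%:E = 0)%E) ->
  (\int[@mu3 R]_z (F (point3 z))%:E = 0)%E.
Proof.
move=> mF F0 FM lines; rewrite /mu3.
have iF : ((mu \x mu) \x mu)%E.-integrable setT (EFin \o (F \o @point3 R)).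
  exact: (bounded_support_integrable (measurable_centered_box M)
    (measure_centered_box_lty M) mF F0 (fun z => FM _)).
(* Bounded support makes every slice integrable, not only almost every one, so Fubini in the plane
   applies at each height [t]. *)
have iF2 (t : mR) :
    (mu \x mu)%E.-integrable setT (fun p => (F (point3 (p, t)))%:E).
  apply: (@bounded_support_integrable _ (mR * mR)%type R _
    (`[(- M)%R, M]%classic `*` `[(- M)%R, M]%classic) (fun p => F (point3 (p, t))) M).
  - by apply: measurableX; exact: measurable_itv.
  - exact: measure_square_lty.
  - apply: (measurableT_comp mF (g := fun p => (p, t))).
    exact: measurable_fun_pair.
  - by move=> p np; apply: F0 => -[].
  - by move=> p; exact: FM.
have int21 := @integral21_prod_meas1 _ _ (mR * mR)%type mR R square_measure mu _ iF.
have int12 := @integral12_prod_meas1 _ _ (mR * mR)%type mR R square_measure mu _ iF.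
(* The measure is built as (x, y), then z: for the last direction one application of Fubini
   suffices, for the first two a second one inside the slice brings [m] innermost. *)
case: (I3P m) lines => -> lines.
- apply: (etrans (esym int21)); apply: integral0_eq => t _.
  apply: (etrans (esym (@integral21_prod_meas1 _ _ mR mR R mu mu _ (iF2 t)))).
  apply: integral0_eq => y _.
  rewrite -(lines (point3 ((0, y), t))); apply: eq_integral => s _.
  congr EFin; congr F; apply/rowP => n; rewrite set_coordE.
  by case: (I3P n) => ->; rewrite !point3E.
- apply: (etrans (esym int21)); apply: integral0_eq => t _.
  apply: (etrans (esym (@integral12_prod_meas1 _ _ mR mR R mu mu _ (iF2 t)))).
  apply: integral0_eq => y _.
  rewrite -(lines (point3 ((y, 0), t))); apply: eq_integral => s _.
  congr EFin; congr F; apply/rowP => n; rewrite set_coordE.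
  by case: (I3P n) => ->; rewrite !point3E.
- apply: (etrans (esym int12)); apply: integral0_eq => p _.
  rewrite -(lines (point3 (p, 0))); apply: eq_integral => s _.
  congr EFin; congr F; apply/rowP => n; rewrite set_coordE.
  by case: (I3P n) => ->; rewrite !point3E.
Qed.

Lemma negligible_plane m (c : R) :
  (@mu3 R).-negligible [set z | point3 z 0 m = c].
Proof.
have mc : @measurable _ mR [set c] by exact: measurable_set1.
have mT : @measurable _ mR setT by exact: measurableT.
have mu0 : mu [set c] = 0%E by exact: lebesgue_measure_set1.
have mu3X (A : set (mR * mR)) (B : set mR) : measurable A -> measurable B ->
    @mu3 R (A `*` B) = ((mu \x mu) A * mu B)%E.
  exact: (@product_measure1E _ _ (mR * mR)%type mR R (mu \x mu)%E mu).
have mu2X (A B : set mR) : measurable A -> measurable B ->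
    ((mu \x mu) (A `*` B) = mu A * mu B)%E.
  exact: (@product_measure1E _ _ mR mR R mu mu).
case: (I3P m) => ->.
- exists (([set c] `*` setT) `*` setT); split.
  + by apply: measurableX => //; exact: measurableX.
  + by rewrite mu3X ?mu2X ?mu0 ?mul0e//; exact: measurableX.
  + by move=> z /=; rewrite point3E.
- exists ((setT `*` [set c]) `*` setT); split.
  + by apply: measurableX => //; exact: measurableX.
  + by rewrite mu3X ?mu2X ?mu0 ?mule0 ?mul0e//; exact: measurableX.
  + by move=> z /=; rewrite point3E.
- exists (setT `*` [set c]); split.
  + by apply: measurableX => //; exact: measurableT.
  + by rewrite mu3X ?mu0 ?mule0//; exact: measurableT.
  + by move=> z /=; rewrite point3E.
Qed.

End LineIntegrals.

(** * Piecewise polynomial functions *)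

Section Piecewise.
Variable R : realType.
Local Notation pt := 'rV[R]_3.
Local Notation mR := (measurableTypeR R).
Implicit Types (T : box R) (s : seq (box R)) (P : box R -> pt -> R) (x : pt).

(** For distinct cells of a mesh the half-open cells are disjoint and at most one term survives. The
    form as a sum makes linearity and measurability immediate. *)
Definition piecewise s P x : R := \sum_(T <- s) \1_(half_open_cell T) x * P T x.

Lemma half_open_cell_sub T : half_open_cell T `<=` cell T.
Proof. by move=> x Tx m; have /andP[-> /ltW] := Tx m. Qed.

Lemma measurable_half_open_cell T :
  @measurable _ (mR * mR * mR)%type (@point3 R @^-1` half_open_cell T).
Proof.
rewrite (_ : _ @^-1` _ = `[T.1 0 0, T.2 0 0[%classic `*` `[T.1 0 1, T.2 0 1[%classic
  `*` `[T.1 0 2, T.2 0 2[%classic).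
  by apply: measurableX; [apply: measurableX|]; exact: measurable_itv.
apply/seteqP; split=> [z Tz|z [[h0 h1] h2] m].
  have := Tz 0; have := Tz 1; have := Tz 2; rewrite !point3E => h2 h1 h0.
  by split; [split|]; rewrite /= in_itv.
by case: (I3P m) => ->; rewrite !point3E; move: h0 h1 h2; rewrite /= !in_itv.
Qed.

Lemma piecewise_measurable s P : (forall T, continuous (P T)) ->
  @measurable_fun _ _ (mR * mR * mR)%type mR setT (piecewise s P \o @point3 R).
Proof.
move=> cP; rewrite /piecewise /comp.
apply: (@measurable_sum _ (mR * mR * mR)%type R setT _ s
  (fun T z => \1_(half_open_cell T) (point3 z) * P T (point3 z))) => T.
apply: measurable_funM; last exact: continuous_measurable3.
apply: (measurable_indic (D := setT)); exact: measurable_half_open_cell.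
Qed.

Lemma cell_compact T : compact (cell T).
Proof.
rewrite (_ : cell T = [set x | forall m, `[T.1 0 m, T.2 0 m]%classic (x ord0 m)]).
  apply: (@rV_compact R 3 (fun m => `[T.1 0 m, T.2 0 m]%classic)) => m.
  exact: segment_compact.
by apply/seteqP; split=> x Tx m; have := Tx m; rewrite /= in_itv.
Qed.

Lemma cell_bound T (f : pt -> R) : continuous f ->
  exists M, forall x, cell T x -> `|f x| <= M.
Proof.
move=> cf.
have /compact_bounded[M [_ HM]] : compact (f @` cell T).
  apply: continuous_compact; last exact: cell_compact.
  exact: continuous_subspaceT.
exists (M + 1) => x Tx; apply: (HM (M + 1)); first by rewrite ltrDl.
by exists x.
Qed.

Lemma piecewise_bound s P : (forall T, continuous (P T)) ->
  exists M, [/\ 0 <= M, forall x, `|piecewise s P x| <= M &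
    forall x m, M < `|x 0 m| -> piecewise s P x = 0].
Proof.
move=> cP; elim: s => [|T s [M [M0 HM HM']]].
  exists 0; split=> // [x|x m _]; by rewrite /piecewise big_nil ?normr0.
have [M1 HM1] := cell_bound T (cP T).
have [M2 HM2] : exists M2, forall x m, cell T x -> `|x 0 m| <= M2.
  have cm (m : 'I_3) : continuous (fun x : pt => x 0 m : R) by exact: coord_continuous.
  have [a Ha] := cell_bound T (cm 0); have [b Hb] := cell_bound T (cm 1).
  have [c Hc] := cell_bound T (cm 2).
  exists (`|a| + `|b| + `|c|) => x m Tx.
  have := Ha _ Tx; have := Hb _ Tx; have := Hc _ Tx.
  have := ler_norm a; have := ler_norm b; have := ler_norm c.
  have := normr_ge0 a; have := normr_ge0 b; have := normr_ge0 c.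
  case: (I3P m) => ->; lra.
have eq x : piecewise (T :: s) P x = \1_(half_open_cell T) x * P T x + piecewise s P x.
  by rewrite /piecewise big_cons.
exists (M + `|M1| + `|M2|); split.
- by rewrite !addr_ge0.
- move=> x; rewrite eq; apply: (le_trans (ler_normD _ _)).
  have h : `|\1_(half_open_cell T) x * P T x| <= `|M1|.
    rewrite indicE; case: (boolP (x \in _)) => [|_]; last by rewrite mul0r normr0.
    rewrite inE mul1r => /half_open_cell_sub Tx.
    by apply: (le_trans (HM1 _ Tx)); exact: ler_norm.
  have := HM x; have := normr_ge0 M2; lra.
- move=> x m xm; rewrite eq (HM' x m); last first.
    by apply: le_lt_trans xm; have := normr_ge0 M1; have := normr_ge0 M2; lra.
  rewrite indicE; case: (boolP (x \in _)) => [|_]; last by rewrite mul0r addr0.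
  rewrite inE => /half_open_cell_sub/(HM2 _ m) h.
  by have := ler_norm M2; have := normr_ge0 M1; lra.
Qed.

Lemma piecewise_support s P : (forall T, continuous (P T)) ->
  exists M, [/\ forall x, `|piecewise s P x| <= M &
    forall z, ~ centered_box M z -> piecewise s P (point3 z) = 0].
Proof.
move=> cP; have [M [M0 HM HM']] := piecewise_bound s cP.
exists M; split=> // z nz.
have [|] := boolP [exists m, M < `|point3 z 0 m|] => [/existsP[m]|/existsPn nM].
  exact: HM'.
exfalso; apply: nz.
have h m : - M <= point3 z 0 m <= M by rewrite -ler_norml leNgt.
by split; [split|]; rewrite /= in_itv /=; [have := h 0|have := h 1|have := h 2];
  rewrite point3E.
Qed.

End Piecewise.

(** * Weak derivatives of piecewise polynomials *)

Section WeakDerivative.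
Variable R : realType.
Local Notation pt := 'rV[R]_3.
Local Notation mR := (measurableTypeR R).
Local Notation mu := (@lebesgue_measure R).
Implicit Types (T : box R) (x : pt) (m : 'I_3).
Variables (Omega : set pt) (Th : seq (box R)) (f : box R -> pt -> R).
Hypotheses (oO : open Omega) (mesh : is_mesh Omega Th).
Hypothesis glue : forall T T' x, T \in Th -> T' \in Th -> cell T x -> cell T' x ->
  f T x = f T' x.
Hypothesis polyf : forall T, is_polyfun (f T).

Local Notation cells := (undup Th).

Lemma piecewiseE (P : box R -> pt -> R) T x : T \in Th -> half_open_cell T x ->
  piecewise cells P x = P T x.
Proof.
move=> TTh Tx; rewrite /piecewise (bigD1_seq T) ?mem_undup ?undup_uniq//=.
rewrite indicE mem_set// mul1r big_seq_cond big1 ?addr0// => T'.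
rewrite mem_undup => /andP[T'Th TT'].
rewrite indicE; case: (boolP (x \in _)); last by rewrite mul0r.
rewrite inE => T'x; exfalso; have [m] := mesh_separated mesh T'Th TTh TT'.
have /andP[a b] := Tx m; have /andP[c d] := T'x m.
by move=> [] h; lra.
Qed.

(** On a line the integrand is a sum over the crossed cells of derivatives cut off to half-open
    intervals; the fundamental theorem of calculus evaluates each. *)
Lemma integral_line_piecewise (F : box R -> pt -> R) x m :
  (forall T y, derivable (F T) y (delta_mx 0 m)) ->
  (forall T, continuous (pderiv m (F T))) ->
  (\int[mu]_t (piecewise cells (fun T => pderiv m (F T)) (set_coord x m t))%:E =
   (\sum_(T <- cells | crosses x m T)
     (F T (set_coord x m (T.2 0 m)) - F T (set_coord x m (T.1 0 m))))%:E)%E.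
Proof.
move=> dF cF; have [cTh _ _ _] := mesh.
pose I T : set mR := `[T.1 0 m, T.2 0 m[%classic.
pose g T (t : mR) : \bar R := (pderiv m (F T) (set_coord x m t))%:E.
have mI T : measurable (I T) by exact: measurable_itv.
have cg T : continuous (fun t : R => pderiv m (F T) (set_coord x m t)).
  move=> t; apply: (@continuous_comp _ _ _ (set_coord x m)); last exact: cF.
  exact: continuous_set_coord.
have ig T : mu.-integrable (I T) (g T).
  apply: (@integrableS _ _ _ mu `[T.1 0 m, T.2 0 m]%classic) => //.
    by move=> t; rewrite /I /= !in_itv /= => /andP[-> /ltW].
  apply: continuous_compact_integrable; first exact: segment_compact.
  by apply: continuous_subspaceT; exact: cg.
have stepE (t : R) : (piecewise cells (fun T => pderiv m (F T)) (set_coord x m t))%:E =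
    (\sum_(T <- cells | crosses x m T) (g T \_ (I T)) t)%E.
  rewrite /piecewise -sumEFin [RHS]big_mkcond; apply: eq_bigr => T _.
  rewrite patchE indicE.
  have -> : (set_coord x m t \in half_open_cell T) =
      crosses x m T && (t \in I T).
    apply/idP/andP => [|[/crossesP Tx]].
      rewrite inE => H; split.
        apply/crossesP => n nm; have := H n.
        by rewrite set_coordE (negPf nm).
      by have := H m; rewrite set_coordE eqxx inE /I /= in_itv.
    rewrite !inE /I /= in_itv /= => tI n; rewrite set_coordE.
    by case: eqVneq => [->|/Tx].
  case: (crosses x m T) => /=; last by rewrite mul0r.
  by case: (t \in I T); rewrite ?mul1r ?mul0r.
under eq_integral do rewrite stepE.
rewrite integral_sum//; last first.
  by move=> T; apply/(integrable_mkcond _ (mI T)).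
rewrite -sumEFin; rewrite big_seq_cond [RHS]big_seq_cond.
apply: eq_bigr => T; rewrite mem_undup => /andP[TTh _].
(* Adding the upper end point does not change the integral and gives the closed interval of
   [line_FTC]. *)
rewrite -integral_mkcond /I integral_itv_bndo_bndc; last exact: measurable_int (ig T).
by apply: line_FTC => //; exact: cTh.
Qed.

(** The complement of a compact set is open, so [phi] vanishes in a neighbourhood of [x]. *)
Lemma pderiv_outside_support (phi : pt -> R) (K : set pt) m x : compact K ->
  (forall y, ~ K y -> phi y = 0) -> ~ K x -> pderiv m phi x = 0.
Proof.
move=> cK phi0 Kx.
have oK : open (~` K).
  by apply: closed_openC; apply: compact_closed => //; exact: norm_hausdorff.
rewrite /pderiv (@near_eq_derive _ _ _ phi (fun=> 0)) ?derive_cst//.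
have : nbhs x (~` K) by exact: open_nbhs_nbhs.
by apply: filterS => y; exact: phi0.
Qed.

Lemma int3_piecewise (P : box R -> pt -> R) : (forall T, continuous (P T)) ->
  (forall x, ~ Omega x -> piecewise cells P x = 0) ->
  int3 Omega (piecewise cells P) =
  \int[@mu3 R]_z (piecewise cells P (point3 z)).
Proof.
move=> cP P0; rewrite /int3 Rintegral_mkcond; apply: eq_Rintegral => z _.
by rewrite patchE; case: ifPn => // /negP; rewrite inE /= => /P0 ->.
Qed.

Lemma piecewise_integrable (P : box R -> pt -> R) : (forall T, continuous (P T)) ->
  (@mu3 R).-integrable setT (fun z => (piecewise cells P (point3 z))%:E).
Proof.
move=> cP; have [M [HM HM0]] := piecewise_support cells cP.
exact: (bounded_support_integrable (measurable_centered_box M)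
    (measure_centered_box_lty M) (piecewise_measurable cells cP) HM0
    (fun z => HM _)).
Qed.

(** By the product rule on each cell, the two sides differ by the integral of the cellwise
    derivative of [f T * phi], and the integral of this along every line parallel to x_m is zero. *)
Lemma piecewise_weak_pderiv m : weak_pderiv Omega m (piecewise cells f)
  (piecewise cells (fun T => pderiv m (f T))).
Proof.
move=> phi [smooth_phi [K [cK KO phi0]]].
have phiO y : ~ Omega y -> phi y = 0 by move=> Oy; apply: phi0 => /KO.
have dphiO y : ~ Omega y -> pderiv m phi y = 0.
  by move=> Oy; apply: (pderiv_outside_support m cK phi0) => /KO.
have [cphi dphi] := smooth_phi [::].
have [cdphi _] := smooth_phi [:: m].
have cf T := polyfun_continuous (polyf T).
have cdf T := polyfun_continuous (polyfun_pderiv m (polyf T)).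
pose F T x := f T x * phi x.
have FE T : pderiv m (F T) = fun x => f T x * pderiv m phi x + pderiv m (f T) x * phi x.
  apply/funext => x; rewrite /pderiv /F deriveM; last exact: dphi.
    by rewrite /GRing.scale /= [phi x * _]mulrC.
  exact: polyfun_derivable.
have dF T y : derivable (F T) y (delta_mx 0 m).
  by apply: derivableM; [exact: polyfun_derivable|exact: dphi].
pose P1 T x := f T x * pderiv m phi x.
pose P2 T x := pderiv m (f T) x * phi x.
have cP1 T : continuous (P1 T) by exact: (continuous_funM (cf T) cdphi).
have cP2 T : continuous (P2 T) by exact: (continuous_funM (cdf T) cphi).
have cF T : continuous (pderiv m (F T)).
  by rewrite FE; exact: (continuous_funD (cP1 T) (cP2 T)).
have -> : (fun x => piecewise cells f x * pderiv m phi x) = piecewise cells P1.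
  apply/funext => x; rewrite /piecewise mulr_suml.
  by apply: eq_bigr => T _; rewrite mulrA.
have -> : (fun x => piecewise cells (fun T => pderiv m (f T)) x * phi x) =
    piecewise cells P2.
  apply/funext => x; rewrite /piecewise mulr_suml.
  by apply: eq_bigr => T _; rewrite mulrA.
rewrite !int3_piecewise//; last first.
- by move=> x /dphiO h; rewrite /piecewise big1// => T _; rewrite /P1 h !mulr0.
- by move=> x /phiO h; rewrite /piecewise big1// => T _; rewrite /P2 h !mulr0.
apply/eqP; rewrite -addr_eq0; apply/eqP.
rewrite -RintegralD//; try exact: piecewise_integrable.
transitivity (fine (\int[@mu3 R]_z
    (piecewise cells (fun T => pderiv m (F T)) (point3 z))%:E)).
  congr fine; apply: eq_integral => z _; congr EFin.
  rewrite /piecewise -big_split; apply: eq_bigr => T _ /=.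
  by rewrite FE mulrDr.
have [M [HM HM0]] := piecewise_support cells cF.
rewrite (integral3_lines_eq0 (m := m) (M := M))//.
- exact: piecewise_measurable.
move=> x; rewrite integral_line_piecewise//.
by rewrite (line_cancellation oO mesh glue).
Qed.

Lemma piecewise_L2 (P : box R -> pt -> R) : (forall T, continuous (P T)) ->
  L2 Omega (piecewise cells P).
Proof.
move=> cP; have mP := piecewise_measurable cells cP.
have mO := open_measurable3 oO.
split; first exact: (measurable_funS measurableT _ mP).
have [M [HM HM0]] := piecewise_support cells cP.
apply: (@integrableS _ _ _ (@mu3 R) setT) => //.
have sq0 z : ~ centered_box M z -> piecewise cells P (point3 z) ^+ 2 = 0.
  by move=> /HM0 ->; rewrite expr0n.
have sqM (z : mR * mR * mR) : `|piecewise cells P (point3 z) ^+ 2| <= M ^+ 2.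
  by rewrite normrX lerXn2r ?nnegrE// (le_trans _ (HM (point3 z))).
exact: (bounded_support_integrable (measurable_centered_box M)
  (measure_centered_box_lty M) (measurable_funX 2 mP) sq0 sqM).
Qed.

Lemma piecewise_ae_eq (v : pt -> R) :
  (forall T x, T \in Th -> open_cell T x -> v x = f T x) ->
  ae_eq3 Omega v (piecewise cells f).
Proof.
move=> vE.
pose N := [set z | exists T m, T \in Th /\
  (point3 z 0 m = T.1 0 m \/ point3 z 0 m = T.2 0 m)].
apply: (@negligibleS _ _ _ (@mu3 R) N).
  move=> z /= /not_implyP[Oz]; apply: contra_notP => Nz.
  (* Off the planes in [N] the half-open inequalities become strict, so the point is inside a
     cell. *)
  have [T TTh Tz] := mesh_quadrant (fun=> false) oO mesh Oz.
  rewrite (piecewiseE _ TTh)//; apply: vE => // m.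
  have /andP[h ->] := Tz m; rewrite andbT lt_neqAle h andbT.
  by apply/eqP => E; apply: Nz; exists T, m; split=> //; left.
(* The exceptional set is a finite union of planes carrying the faces of the cells. *)
rewrite /N; elim: Th => [|T s IH].
  apply: (@negligibleS _ _ _ (@mu3 R) set0); last exact: negligible_set0.
  by move=> z [T [m []]].
pose plane m c : set (R * R * R) := [set z | point3 z 0 m = c].
apply: (@negligibleS _ _ _ (@mu3 R) ([set z | exists T m, T \in s /\
  (point3 z 0 m = T.1 0 m \/ point3 z 0 m = T.2 0 m)] `|`
  ((plane 0 (T.1 0 0) `|` plane 0 (T.2 0 0)) `|`
   ((plane 1 (T.1 0 1) `|` plane 1 (T.2 0 1)) `|`
    (plane 2 (T.1 0 2) `|` plane 2 (T.2 0 2)))))).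
  move=> z [T' [m [+ H]]]; rewrite inE => /predU1P[T'E|T's]; last first.
    by left; exists T', m.
  right; rewrite -T'E; case: (I3P m) H => -> H; [left|right; left|right; right]; exact: H.
by apply: negligibleU => //; apply: negligibleU; [|apply: negligibleU];
  apply: negligibleU; exact: negligible_plane.
Qed.

Lemma piecewise_H1 (v : pt -> R) :
  (forall T x, T \in Th -> open_cell T x -> v x = f T x) -> H1 Omega v.
Proof.
move=> vE; exists (piecewise cells f); split.
- exact: piecewise_ae_eq.
- by apply: piecewise_L2 => T; exact: polyfun_continuous.
move=> m; exists (piecewise cells (fun T => pderiv m (f T))); split.
  by apply: piecewise_L2 => T; apply: polyfun_continuous; exact: polyfun_pderiv.
exact: piecewise_weak_pderiv.
Qed.

End WeakDerivative.

Theorem proposition4p2 (R : realType) (k : nat) (hk : (2 <= k)%N) :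
  (forall (T : box R)
          (B : 'I_3 -> moment_type -> position -> seq ('rV[R]_3 -> R)),
     cuboid T ->
     (forall (i : 'I_3) (r : moment_type) (e : position),
        r \in moments k i -> is_basis setT (Q r.2) (B i r e)) ->
     unisolvent (shape_space k) (dofs k T B)) /\
  (forall (Omega : set 'rV[R]_3) (Th : seq (box R)),
     open Omega -> connected Omega -> contractible Omega ->
     lipschitz_boundary Omega -> is_mesh Omega Th ->
     fe_space k Th `<=` H1_field Omega).
Proof.
split=> [T B cT basisB|Omega Th oO _ _ _ mesh u [w [Xw uw Hv Hm]] i].
  exact: dofs_unisolvent.
have [cTh _ _ inter] := mesh.
(* The value 0 off the mesh makes [f T] polynomial for every box, since [fe_space] constrains [w]
   only on cells of [Th]. *)
pose f (T : box R) := if T \in Th then Defs.comp (w T) i else fun=> 0.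
have fE T : T \in Th -> f T = Defs.comp (w T) i by rewrite /f => ->.
apply: (@piecewise_H1 R Omega Th f oO mesh).
- move=> T T' x TTh T'Th Tx T'x; rewrite !fE//.
  have [->//|TT'] := eqVneq T T'.
  have [T0|[e [e' [ee' cE]]]] := inter T T' TTh T'Th.
    by have : (cell T `&` cell T') x by []; rewrite T0.
  apply: (@fe_trace_eq R k w T T' e e' i x hk (cTh _ TTh) (cTh _ T'Th) TT'
    (Xw _ TTh) (Xw _ T'Th)) => //.
  + by move=> v v' j D v0 vv' Dj; apply: Hv.
  + by move=> e1 e1' j r p ee1 rk er Qp; apply: Hm.
  + by rewrite -cE.
- move=> T; rewrite /f; case: ifP => [TTh|_]; last exact: polyfun0.
  exact: (shape_space_polyfun i (Xw _ TTh)).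
- by move=> T x TTh Tx; rewrite fE// /Defs.comp (uw T).
Qed.
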